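(* Let $(F,\partial)$ be a differential field of characteristic zero with field of constants $K=C_F$, and let $G$ be a linear algebraic group over $K$. (a) Let $R/F$ be a Picard-Vessiot ring with differential Galois group $G$. Then $\mathrm{Spec}(R)$ is a simple differential $G_F$-torsor. (b) Let $X=\mathrm{Spec}(R)$ be a differential $G_F$-torsor such that $R$ is an integral domain, and assume that $C_{\mathrm{Frac}(R)}=K$. Then $R/F$ is a Picard-Vessiot ring with differential Galois group $G$.
   Context: $C_R=\{f\in R\mid\partial(f)=0\}$ denotes the constants of a differential ring $R$; $R$ is simple if it has no non-trivial ideals closed under $\partial$. A linear algebraic group over $K$ is an affine group scheme of finite type over $K$; $F[G]:=F\otimes_K K[G]$ is a differential ring extension of $F$ in which elements of $K[G]$ are constant. A $G_F$-torsor is a non-empty affine scheme $X$ of finite type over $F$ with a right $G_F$-action such that for every $F$-algebra $A$ and all $x,y\in X(A)$ there is a unique $g\in G(A)$ with $y=x.g$. A differential $G_F$-torsor is a $G_F$-torsor $X$ with an extension of $\partial$ from $F$ to $F[X]$ such that the co-action $F[X]\to F[X]\otimes_F F[G]$ is a differential homomorphism; it is simple if $F[X]$ is a simple differential ring. A Picard-Vessiot ring over $F$ is a differential ring extension $R/F$ of the form $R=F[Z,\det(Z)^{-1}]$ (generated over $F$ by the entries of $Z$ and $\det(Z)^{-1}$) for some $Z\in\mathrm{GL}_n(R)$ with $\partial(Z)Z^{-1}\in F^{n\times n}$, such that $R$ is a simple differential ring and $C_R=K$. Its differential Galois group is the group functor $\underline{\mathrm{Aut}}^{\partial}(R/F)$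 sending a $K$-algebra $A$ to the group of differential $F\otimes_K A$-automorphisms of $R\otimes_K A$ ($A$ constant); it is an affine group scheme of finite type over $K$, represented by $C_{R\otimes_F R}$. ''$R/F$ has differential Galois group $G$'' means $\underline{\mathrm{Aut}}^{\partial}(R/F)$ is identified with $G$; the right action of $G_F$ on $\mathrm{Spec}(R)$ is the one corresponding to the left action of $G$ on $R$. *)

(* Defs.v *)
From HB Require Import structures.
From mathcomp Require Import all_boot all_order all_algebra.
From mathcomp Require Import boolp classical_sets.
From mathcomp Require Import ring.
From mathcomp Require Import generic_quotient ring_quotient.

Set Implicit Arguments.
Unset Strict Implicit.
Unset Printing Implicit Defensive.

Import GRing.Theory.
Local Open Scope ring_scope.
Local Open Scope quotient_scope.

(* [comNzRingType] and [comAlgType] exclude the zero ring, so the functors of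
   points below are only evaluated at nonzero algebras.  Nothing is lost: each
   of them has exactly one point over the zero algebra. *)

HB.mixin Record isDifferential R of GRing.NzRing R := {
  der : R -> R;
  derD : {morph der : x y / x + y};
  derM : forall x y : R, der (x * y) = der x * y + x * der y
}.

#[short(type="diffRingType")]
HB.structure Definition DiffRing :=
  {R of isDifferential R & GRing.ComNzRing R}.

#[short(type="diffIdomainType")]
HB.structure Definition DiffIdomain :=
  {R of isDifferential R & GRing.IntegralDomain R}.

#[short(type="diffFieldType")]
HB.structure Definition DiffField :=
  {R of isDifferential R & GRing.Field R}.

HB.mixin Record isDiffAlgebra (F : diffRingType) R
    of GRing.ComAlgebra F R & DiffRing R := {
  der_alg : forall a : F, der (a%:A : R) = (der a)%:A
}.

#[short(type="diffAlgType")]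
HB.structure Definition DiffAlgebra (F : diffRingType) :=
  {R of GRing.ComAlgebra F R & DiffRing R & isDiffAlgebra F R}.

#[short(type="diffIdomainAlgType")]
HB.structure Definition DiffIdomainAlgebra (F : diffRingType) :=
  {R of DiffAlgebra F R & GRing.IntegralDomain R}.

Section DerTheory.
Variable R : diffRingType.

Lemma der0 : der (0 : R) = 0.
Proof. by apply: (addrI (der (0 : R))); rewrite -derD !addr0. Qed.

Lemma derN : {morph (@der R) : x / - x}.
Proof. by move=> x; apply: (addrI (der x)); rewrite -derD !subrr der0. Qed.

Lemma derB : {morph (@der R) : x y / x - y}.
Proof. by move=> x y; rewrite derD derN. Qed.

Lemma der1 : der (1 : R) = 0.
Proof.
by apply: (addrI (der (1 : R))); rewrite -{3}[1]mulr1 derM mulr1 mul1r addr0.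
Qed.
End DerTheory.

Lemma derZ (F : diffRingType) (R : diffAlgType F) (a : F) (x : R) :
  der (a *: x) = der a *: x + a *: der x.
Proof.
by rewrite -[x in LHS]mul1r scalerAl derM der_alg -!scalerAl !mul1r.
Qed.

HB.instance Definition _ (F : diffRingType) :=
  isDifferential.Build F^o (@derD F) (@derM F).
Fact regular_der_alg (F : diffRingType) (a : F) :
  der (a%:A : F^o) = (der a)%:A.
Proof. by rewrite /GRing.scale /= !mulr1. Qed.
HB.instance Definition _ (F : diffRingType) :=
  isDiffAlgebra.Build F F^o (@regular_der_alg F).

Section Constants.
Variable F : diffFieldType.

Definition is_const : {pred F} := [pred x | der x == 0].

Fact is_const_divring : divring_closed is_const.
Proof.
have dV (y : F) : der y = 0 -> der y^-1 = 0.
  move=> dy; have [->|y0] := eqVneq y 0; first by rewrite invr0 der0.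
  have : der (y * y^-1) = 0 by rewrite divff // der1.
  rewrite derM dy mul0r add0r => /eqP; rewrite mulf_eq0 (negPf y0) /=.
  by move/eqP.
split; first by rewrite inE der1.
- by move=> x y; rewrite !inE => /eqP dx /eqP dy; rewrite derB dx dy subr0.
- move=> x y; rewrite !inE => /eqP dx /eqP dy.
  by rewrite derM dx dV // mul0r mulr0 addr0.
Qed.
HB.instance Definition _ := GRing.isDivringClosed.Build F is_const
  is_const_divring.

Record const : predArgType :=
  Const { const_val :> F; _ : const_val \in is_const }.
HB.instance Definition _ := [isSub for const_val].
HB.instance Definition _ := [Choice of const by <:].
HB.instance Definition _ := [SubChoice_isSubIntegralDomain of const by <:].
HB.instance Definition _ := [SubIntegralDomain_isSubField of const by <:].

Fact const_derD : {morph (fun=> 0) : x y / x + y :> const}.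
Proof. by move=> x y; rewrite addr0. Qed.
Fact const_derM (x y : const) : 0 = 0 * y + x * 0.
Proof. by rewrite mul0r mulr0 addr0. Qed.
HB.instance Definition _ := isDifferential.Build const const_derD const_derM.

Lemma der_const (c : const) : der (val c) = 0.
Proof. by apply/eqP; have := valP c; rewrite inE. Qed.
End Constants.

Section FracDer.
Variable R : diffIdomainType.
Local Notation "x %:F" := (@FracField.tofrac R x).

(* [frac_derE] below: this is the quotient rule for every representation     *)
(* n / d, not only for the representative [repr x].                          *)
Definition frac_der (x : {fraction R}) : {fraction R} :=
  let r := repr x in
  (der \n_r * \d_r - \n_r * der \d_r)%:F / (\d_r ^+ 2)%:F.

Lemma fracE (x : {fraction R}) : x = (\n_(repr x))%:F / (\d_(repr x))%:F.
Proof.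
have d0 := denom_ratioP (repr x).
apply: (mulIf (x := (\d_(repr x))%:F)); first by rewrite tofrac_eq0.
rewrite mulfVK ?tofrac_eq0 // -{1}[x]reprK; unlock FracField.tofrac.
rewrite -[LHS]FracField.pi_mul; apply/eqmodP; rewrite /= FracField.equivfE.
rewrite /FracField.mulf !numden_Ratio ?mulf_neq0 ?oner_neq0 //.
by rewrite !mulr1 mulrC.
Qed.

Lemma frac_derE (n d : R) : d != 0 ->
  frac_der (n%:F / d%:F) = (der n * d - n * der d)%:F / (d ^+ 2)%:F.
Proof.
move=> d0; rewrite /frac_der; set x := n%:F / d%:F.
have e0 := denom_ratioP (repr x); have := fracE x.
move: (\n_(repr x)) (\d_(repr x)) e0 => m e e0; rewrite {}/x => /eqP.
rewrite eqr_div ?tofrac_eq0 // -!tofracM tofrac_eq => /eqP nemd.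
apply/eqP; rewrite eqr_div ?tofrac_eq0 ?expf_neq0 // -!tofracM tofrac_eq.
have := congr1 (@der R) nemd; rewrite !derM => D.
apply/eqP; rewrite !mulrBl.
have -> : der m * e * d ^+ 2 = e * d * (der m * d) by ring.
have -> : der n * d * e ^+ 2 = e * d * (der n * e) by ring.
have -> : der m * d = der n * e + n * der e - m * der d.
  by rewrite D addrK.
rewrite mulrBr mulrDr.
have -> : m * der e * d ^+ 2 = (m * d) * (der e * d) by ring.
have -> : n * der d * e ^+ 2 = (n * e) * (der d * e) by ring.
rewrite -nemd.
have -> : e * d * (m * der d) = (m * d) * (der d * e) by ring.
by rewrite -nemd; ring.
Qed.

Lemma frac_ind (P : {fraction R} -> Prop) :
  (forall n d, d != 0 -> P (n%:F / d%:F)) -> forall x, P x.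
Proof. by move=> IH x; rewrite [x]fracE; apply/IH/denom_ratioP. Qed.

Fact frac_derD : {morph frac_der : x y / x + y}.
Proof.
elim/frac_ind=> n d d0; elim/frac_ind=> m e e0.
have F0 := (tofrac_eq0, d0, e0).
rewrite addf_div ?tofrac_eq0 // -!tofracM -tofracD.
rewrite !frac_derE ?mulf_neq0 // addf_div ?tofrac_eq0 ?expf_neq0 //.
rewrite -!tofracM -tofracD; apply/eqP.
rewrite eqr_div ?tofrac_eq0 ?mulf_neq0 ?expf_neq0 //.
by rewrite -!tofracM tofrac_eq !derD !derM; apply/eqP; ring.
Qed.

Fact frac_derM (x y : {fraction R}) :
  frac_der (x * y) = frac_der x * y + x * frac_der y.
Proof.
elim/frac_ind: x => n d d0; elim/frac_ind: y => m e e0.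
rewrite !frac_derE // !mulf_div -!tofracM frac_derE ?mulf_neq0 //.
rewrite addf_div ?tofrac_eq0 ?mulf_neq0 ?expf_neq0 // -!tofracM -tofracD.
apply/eqP; rewrite eqr_div ?tofrac_eq0 ?mulf_neq0 ?expf_neq0 //.
by rewrite -!tofracM tofrac_eq !derM; apply/eqP; ring.
Qed.

HB.instance Definition _ :=
  isDifferential.Build {fraction R} frac_derD frac_derM.

Lemma der_tofrac (x : R) : der (x%:F) = (der x)%:F.
Proof.
rewrite -[x%:F in LHS]divr1 -tofrac1 /der /= frac_derE ?oner_neq0 //.
by rewrite der1 mulr0 subr0 mulr1 expr1n tofrac1 divr1.
Qed.
End FracDer.

Section Tensor.
Variables (k : fieldType) (A B : comAlgType k).

(* Finite formal sums of symbols a (x) b, modulo the defining relations.     *)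
Inductive tensor_rel : seq (A * B) -> seq (A * B) -> Prop :=
| trel_refl s : tensor_rel s s
| trel_sym s t : tensor_rel s t -> tensor_rel t s
| trel_trans s t u : tensor_rel s t -> tensor_rel t u -> tensor_rel s u
| trel_cat s s' t t' :
    tensor_rel s s' -> tensor_rel t t' -> tensor_rel (s ++ t) (s' ++ t')
| trel_catC s t : tensor_rel (s ++ t) (t ++ s)
| trel_Dl a a' b : tensor_rel [:: (a + a', b)] [:: (a, b); (a', b)]
| trel_Dr a b b' : tensor_rel [:: (a, b + b')] [:: (a, b); (a, b')]
| trel_Z (c : k) a b : tensor_rel [:: (c *: a, b)] [:: (a, c *: b)]
| trel_0 b : tensor_rel [:: (0, b)] [::].

Definition tensor_relb (s t : seq (A * B)) : bool := `[< tensor_rel s t >].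

Fact tensor_relb_refl : reflexive tensor_relb.
Proof. by move=> s; apply/asboolP/trel_refl. Qed.
Fact tensor_relb_sym : symmetric tensor_relb.
Proof. by move=> s t; apply/asboolP/asboolP; apply: trel_sym. Qed.
Fact tensor_relb_trans : transitive tensor_relb.
Proof.
move=> t s u /asboolP st /asboolP tu; apply/asboolP; exact: trel_trans tu.
Qed.
Canonical tensor_equiv :=
  EquivRel tensor_relb tensor_relb_refl tensor_relb_sym tensor_relb_trans.

Definition tensor := {eq_quot tensor_relb}.
HB.instance Definition _ : EqQuotient _ tensor_relb tensor :=
  EqQuotient.on tensor.
HB.instance Definition _ := Choice.on tensor.

Definition tclass (s : seq (A * B)) : tensor := \pi_tensor s.

Lemma tclassP s t : reflect (tclass s = tclass t) (tensor_relb s t).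
Proof. exact: (@eqquotP _ _ tensor). Qed.

Lemma tclass_eq s t : tensor_rel s t -> tclass s = tclass t.
Proof. by move=> st; apply/tclassP/asboolP. Qed.

Lemma tclassK (x : tensor) : tclass (repr x) = x.
Proof. exact: reprK. Qed.

Lemma tensor_relK s : tensor_rel (repr (tclass s)) s.
Proof. by apply/asboolP/tclassP; rewrite tclassK. Qed.

Section Lift.
Variables (M : zmodType) (f : A -> B -> M).

(* The additive map a (x) b |-> f a b; meaningful when [f] is balanced.      *)
Definition tensor_lift (x : tensor) : M := \sum_(p <- repr x) f p.1 p.2.

Definition balanced : Prop :=
  [/\ forall a a' b, f (a + a') b = f a b + f a' b,
      forall a b b', f a (b + b') = f a b + f a b' &
      forall c a b, f (c *: a) b = f a (c *: b)].

Lemma tensor_rel_sum s t : balanced -> tensor_rel s t ->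
  \sum_(p <- s) f p.1 p.2 = \sum_(p <- t) f p.1 p.2.
Proof.
move=> [fDl fDr fZ]; elim=> {s t} //= [s t u _ -> _ -> //||||||].
- by move=> s s' t t' _ ss' _ tt'; rewrite !big_cat /= ss' tt'.
- by move=> s t; rewrite !big_cat /= addrC.
- by move=> a a' b; rewrite !big_cons big_nil /= fDl !addr0.
- by move=> a b b'; rewrite !big_cons big_nil /= fDr !addr0.
- by move=> c a b; rewrite !big_seq1 /= fZ.
move=> b; rewrite big_seq1 big_nil /=; apply: (addrI (f 0 b)).
by rewrite -fDl !addr0.
Qed.

Lemma tensor_liftE s : balanced ->
  tensor_lift (tclass s) = \sum_(p <- s) f p.1 p.2.
Proof. by move=> fb; apply/tensor_rel_sum/tensor_relK. Qed.
End Lift.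

Definition tens (a : A) (b : B) : tensor := tclass [:: (a, b)].

Definition tensor_add (x y : tensor) := tclass (repr x ++ repr y).
Definition tensor_opp (x : tensor) := tclass [seq (- p.1, p.2) | p <- repr x].

Lemma tensor_addE s t : tensor_add (tclass s) (tclass t) = tclass (s ++ t).
Proof. by apply/tclass_eq/trel_cat; apply: tensor_relK. Qed.

Fact tensor_addA : associative tensor_add.
Proof.
by move=> x y z; rewrite -[x]tclassK -[y]tclassK -[z]tclassK !tensor_addE catA.
Qed.
Fact tensor_addC : commutative tensor_add.
Proof. by move=> x y; apply/tclass_eq/trel_catC. Qed.
Fact tensor_add0 : left_id (tclass [::]) tensor_add.
Proof. by move=> x; rewrite -[x]tclassK tensor_addE. Qed.
Fact tensor_addN : left_inverse (tclass [::]) tensor_opp tensor_add.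
Proof.
move=> x; rewrite -{2}[x]tclassK /tensor_opp tensor_addE; apply: tclass_eq.
elim: (repr x) => [|[a b] s IH] /=; first exact: trel_refl.
set m := map _ s in IH *; rewrite -cat1s.
have H1 : tensor_rel (m ++ (a, b) :: s) ([:: (a, b)] ++ (m ++ s)).
  rewrite -(cat1s (a, b)) !catA; apply: trel_cat; last exact: trel_refl.
  exact: trel_catC.
apply: trel_trans (trel_cat (trel_refl _) H1) _; rewrite catA.
rewrite -[X in tensor_rel _ X]/([::] ++ [::]); apply: trel_cat IH.
apply: trel_trans (trel_0 b); rewrite -(addNr a); exact/trel_sym/trel_Dl.
Qed.
HB.instance Definition _ := GRing.isZmodule.Build tensor
  tensor_addA tensor_addC tensor_add0 tensor_addN.

Lemma tclass_cat s t : tclass (s ++ t) = tclass s + tclass t.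
Proof. by rewrite -tensor_addE. Qed.

Lemma tclass_sum s : tclass s = \sum_(p <- s) tens p.1 p.2.
Proof.
elim: s => [|[a b] s IH]; first by rewrite big_nil.
by rewrite big_cons -IH -cat1s tclass_cat.
Qed.

Lemma tensor_sum x : x = \sum_(p <- repr x) tens p.1 p.2.
Proof. by rewrite -tclass_sum tclassK. Qed.

Lemma tensDl a a' b : tens (a + a') b = tens a b + tens a' b.
Proof. by rewrite /tens -tclass_cat; apply/tclass_eq/trel_Dl. Qed.
Lemma tensDr a b b' : tens a (b + b') = tens a b + tens a b'.
Proof. by rewrite /tens -tclass_cat; apply/tclass_eq/trel_Dr. Qed.
Lemma tensZ c a b : tens (c *: a) b = tens a (c *: b).
Proof. exact/tclass_eq/trel_Z. Qed.

Lemma tens_balanced : balanced tens.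
Proof. by split; [exact: tensDl|exact: tensDr|exact: tensZ]. Qed.

Lemma tensor_ind (P : tensor -> Prop) :
  P 0 -> (forall x y, P x -> P y -> P (x + y)) -> (forall a b, P (tens a b)) ->
  forall x, P x.
Proof.
move=> P0 PD Pt x; rewrite [x]tensor_sum.
by apply: (@big_ind _ P) => // p _; apply: Pt.
Qed.

Section LiftTheory.
Variables (M : zmodType) (f : A -> B -> M).
Hypothesis fb : balanced f.

Lemma tensor_lift_tens a b : tensor_lift f (tens a b) = f a b.
Proof. by rewrite tensor_liftE // big_seq1. Qed.

Lemma tensor_liftD : {morph tensor_lift f : x y / x + y}.
Proof.
move=> x y; rewrite -[x]tclassK -[y]tclassK -tclass_cat !tensor_liftE //.
by rewrite big_cat.
Qed.

Lemma tensor_lift0 : tensor_lift f 0 = 0.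
Proof. by rewrite tensor_liftE // big_nil. Qed.
End LiftTheory.

Definition tensor_mul (x y : tensor) : tensor :=
  tensor_lift (fun a b =>
    tensor_lift (fun a' b' => tens (a * a') (b * b')) y) x.

Lemma mul_balanced a b : balanced (fun a' b' => tens (a * a') (b * b')).
Proof.
split=> [a1 a2 b1|a1 b1 b2|c a1 b1].
- by rewrite mulrDr tensDl.
- by rewrite mulrDr tensDr.
- by rewrite -!scalerAr tensZ.
Qed.

Lemma mul_balanced2 y : balanced (fun a b =>
  tensor_lift (fun a' b' => tens (a * a') (b * b')) y).
Proof.
split=> [a1 a2 b1|a1 b1 b2|c a1 b1]; rewrite /tensor_lift -?big_split /=;
  apply: eq_bigr => p _.
- by rewrite mulrDl tensDl.
- by rewrite mulrDl tensDr.
- by rewrite -!scalerAl tensZ.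
Qed.

Lemma tensor_mulE a b a' b' :
  tensor_mul (tens a b) (tens a' b') = tens (a * a') (b * b').
Proof.
rewrite /tensor_mul tensor_lift_tens; last exact: mul_balanced2.
by rewrite tensor_lift_tens //; apply: mul_balanced.
Qed.

Fact tensor_mulDl : left_distributive tensor_mul +%R.
Proof. by move=> x y z; apply/tensor_liftD/mul_balanced2. Qed.

Lemma tensor_mulDr : right_distributive tensor_mul +%R.
Proof.
move=> x y z; rewrite /tensor_mul /(tensor_lift _ x) -big_split /=.
by apply: eq_bigr => p _; apply/tensor_liftD/mul_balanced.
Qed.

Lemma tensor_mul0l x : tensor_mul 0 x = 0.
Proof. exact/tensor_lift0/mul_balanced2. Qed.

Lemma tensor_mul0r x : tensor_mul x 0 = 0.
Proof. by apply: (addrI (tensor_mul x 0)); rewrite -tensor_mulDr !addr0. Qed.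

Fact tensor_mulC : commutative tensor_mul.
Proof.
move=> x y; elim/tensor_ind: x => [|x x' IH IH'|a b].
- by rewrite tensor_mul0l tensor_mul0r.
- by rewrite tensor_mulDl tensor_mulDr IH IH'.
elim/tensor_ind: y => [|y y' IH IH'|a' b'].
- by rewrite tensor_mul0l tensor_mul0r.
- by rewrite tensor_mulDl tensor_mulDr IH IH'.
by rewrite !tensor_mulE mulrC (mulrC b).
Qed.

Fact tensor_mulA : associative tensor_mul.
Proof.
move=> x y z; elim/tensor_ind: x => [|x x' IH IH'|a b].
- by rewrite !tensor_mul0l.
- by rewrite !tensor_mulDl IH IH'.
elim/tensor_ind: y => [|y y' IH IH'|a' b'].
- by rewrite !(tensor_mul0l, tensor_mul0r).
- by rewrite !(tensor_mulDl, tensor_mulDr) IH IH'.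
elim/tensor_ind: z => [|z z' IH IH'|a'' b''].
- by rewrite !tensor_mul0r.
- by rewrite !tensor_mulDr IH IH'.
by rewrite !tensor_mulE !mulrA.
Qed.

Fact tensor_mul1 : left_id (tens 1 1) tensor_mul.
Proof.
elim/tensor_ind=> [|x y IH IH'|a b].
- by rewrite tensor_mul0r.
- by rewrite tensor_mulDr IH IH'.
by rewrite tensor_mulE !mul1r.
Qed.

Definition tensor_scale (c : k) (x : tensor) : tensor :=
  tensor_mul (tens c%:A 1) x.

Lemma tensor_scaleE c a b : tensor_scale c (tens a b) = tens (c *: a) b.
Proof. by rewrite /tensor_scale tensor_mulE -scalerAl !mul1r. Qed.

(* A (x) B is nonzero over a field: split the line k.1 off A and project.    *)
Lemma unit_retract : exists phi : A -> k,
  [/\ forall a a', phi (a + a') = phi a + phi a',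
      forall c a, phi (c *: a) = c * phi a & phi 1 = 1].
Proof.
pose P (V : set A) := [/\ forall v w, V v -> V w -> V (v + w),
   forall c v, V v -> V (c *: v) & ~ V 1].
have [FF FP FT|V [[VD VZ V1] Vmax]] := @Zorn_bigcup A P.
  split=> [v w [X FX Xv] [Y FY Yw]|c v [X FX Xv]|[X FX X1]].
  - have [XY|YX] := FT _ _ FX FY.
      by exists Y => //; have [D _ _] := FP _ FY; apply: D => //; apply: XY.
    by exists X => //; have [D _ _] := FP _ FX; apply: D => //; apply: YX.
  - by exists X => //; have [_ Z _] := FP _ FX; apply: Z.
  - by have [_ _] := FP _ FX; apply.
have V0 : V 0.
  have [[v Vv]|nV] := pselect (exists v, V v).
    by rewrite -(scale0r v); apply: VZ.
  case: (Vmax (fun w => w = 0)).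
    split=> [v Vv|sub]; first by case: nV; exists v.
    by apply: nV; exists 0; apply: sub.
  split=> [v w -> ->|c v ->|/eqP]; rewrite ?addr0 ?scaler0 //=.
  by rewrite oner_eq0.
have VN v : V v -> V (- v) by rewrite -scaleN1r; apply: VZ.
have dec a : exists c : k, V (a - c%:A).
  have [Va|nVa] := pselect (V a); first by exists 0; rewrite scale0r subr0.
  have [[c [v [Vv c1]]]|nW] := pselect (exists c v, V v /\ 1 = v + c *: a).
    have c0 : c != 0.
      by apply/eqP=> c0; apply: V1; rewrite c1 c0 scale0r addr0.
    exists c^-1; rewrite [in _%:A]c1 scalerDr scalerA mulVf // scale1r opprD.
    by rewrite addrCA subrr addr0; apply/VN/VZ.
  case: (Vmax (fun w => exists c v, V v /\ w = v + c *: a)).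
    split=> [v Vv|sub]; first by exists 0, v; rewrite scale0r addr0.
    by apply: nVa; apply: sub; exists 1, 0; rewrite add0r scale1r.
  split=> [_ _ [c [v [Vv ->]]] [d [w [Vw ->]]]|d _ [c [v [Vv ->]]]|//].
    exists (c + d), (v + w); split; first exact: VD.
    by rewrite scalerDl addrACA.
  exists (d * c), (d *: v); split; first exact: VZ.
  by rewrite scalerDr scalerA.
have uniq a c d : V (a - c%:A) -> V (a - d%:A) -> c = d.
  move=> Vc Vd; apply/eqP; rewrite -subr_eq0; apply/eqP/eqP.
  apply: contra_notT V1.
  move=> cd; rewrite -[1](scale1r 1) -(mulVf cd) -scalerA; apply: VZ.
  have -> : (c - d)%:A = (a - d%:A) + - (a - c%:A) :> A.
    by rewrite opprB [RHS]addrC addrA subrK scalerBl.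
  exact/VD/VN.
pose phi a := sval (cid (dec a)).
have phiP a : V (a - (phi a)%:A) by rewrite /phi; case: cid.
exists phi; split=> [a a'|c a|].
- apply: uniq (phiP _) _; rewrite scalerDl opprD addrACA; exact: VD.
- by apply: uniq (phiP _) _; rewrite -scalerA -scalerBr; apply: VZ.
- by apply: uniq (phiP _) _; rewrite scale1r subrr.
Qed.

Fact tensor_nz : tens 1 1 != 0.
Proof.
have [phi [phiD phiZ phi1]] := unit_retract.
have fb : balanced (fun (a : A) (b : B) => phi a *: b).
  split=> [a a' b|a b b'|c a b]; first by rewrite phiD scalerDl.
    by rewrite scalerDr.
  by rewrite phiZ scalerA mulrC.
apply/eqP => /(congr1 (tensor_lift (fun a b => phi a *: b))).
rewrite tensor_lift_tens // tensor_lift0 // phi1 scale1r => /eqP.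
by rewrite oner_eq0.
Qed.

HB.instance Definition _ := GRing.Zmodule_isComNzRing.Build tensor
  tensor_mulA tensor_mulC tensor_mul1 tensor_mulDl tensor_nz.

Fact tensor_scaleA c d x :
  tensor_scale c (tensor_scale d x) = tensor_scale (c * d) x.
Proof.
by rewrite /tensor_scale tensor_mulA tensor_mulE mulr1 -scalerAl mul1r scalerA.
Qed.
Fact tensor_scale1 : left_id 1 tensor_scale.
Proof. by move=> x; rewrite /tensor_scale scale1r tensor_mul1. Qed.
Fact tensor_scaleDr : right_distributive tensor_scale +%R.
Proof. by move=> c x y; apply: tensor_mulDr. Qed.
Fact tensor_scaleDl x : {morph tensor_scale^~ x : c d / c + d}.
Proof. by move=> c d; rewrite /tensor_scale scalerDl tensDl tensor_mulDl. Qed.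
HB.instance Definition _ := GRing.Zmodule_isLmodule.Build k tensor
  tensor_scaleA tensor_scale1 tensor_scaleDr tensor_scaleDl.
Fact tensor_scaleAl (c : k) (x y : tensor) : c *: (x * y) = (c *: x) * y.
Proof. exact: tensor_mulA. Qed.
HB.instance Definition _ := GRing.Lmodule_isLalgebra.Build k tensor
  tensor_scaleAl.
HB.instance Definition _ := GRing.Lalgebra_isComAlgebra.Build k tensor.

Lemma tensM a b a' b' : tens (a * a') (b * b') = tens a b * tens a' b'.
Proof. by rewrite -tensor_mulE. Qed.
Lemma tensZl c a b : tens (c *: a) b = c *: tens a b.
Proof. by rewrite -tensor_scaleE. Qed.
Lemma tensZr c a b : tens a (c *: b) = c *: tens a b.
Proof. by rewrite -tensZ tensZl. Qed.

Definition tinl (a : A) : tensor := tens a 1.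
Definition tinr (b : B) : tensor := tens 1 b.

Fact tinl_zmod : zmod_morphism tinl.
Proof. by move=> a b; apply/eqP; rewrite eq_sym subr_eq -tensDl subrK. Qed.
Fact tinl_monoid : monoid_morphism tinl.
Proof. by split=> // a b; rewrite -tensM mulr1. Qed.
Fact tinl_scalable : scalable tinl.
Proof. by move=> c a; rewrite /tinl tensZl. Qed.
HB.instance Definition _ := GRing.isZmodMorphism.Build A tensor tinl tinl_zmod.
HB.instance Definition _ :=
  GRing.isMonoidMorphism.Build A tensor tinl tinl_monoid.
HB.instance Definition _ :=
  GRing.isScalable.Build k A tensor *:%R tinl tinl_scalable.

Fact tinr_zmod : zmod_morphism tinr.
Proof. by move=> a b; apply/eqP; rewrite eq_sym subr_eq -tensDr subrK. Qed.
Fact tinr_monoid : monoid_morphism tinr.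
Proof. by split=> // a b; rewrite -tensM mulr1. Qed.
Fact tinr_scalable : scalable tinr.
Proof. by move=> c a; rewrite /tinr tensZr. Qed.
HB.instance Definition _ := GRing.isZmodMorphism.Build B tensor tinr tinr_zmod.
HB.instance Definition _ :=
  GRing.isMonoidMorphism.Build B tensor tinr tinr_monoid.
HB.instance Definition _ :=
  GRing.isScalable.Build k B tensor *:%R tinr tinr_scalable.

Lemma tensE a b : tens a b = tinl a * tinr b.
Proof. by rewrite -tensM mulr1 mul1r. Qed.

End Tensor.

Arguments tens {k A B}.
Arguments tinl {k A B}.
Arguments tinr {k A B}.

(* The algebra map a (x) b |-> f a * g b.                                    *)
Section TensorCopair.
Variables (k : fieldType) (A B C : comAlgType k).
Variables (f : {lrmorphism A -> C}) (g : {lrmorphism B -> C}).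

Definition tcopair : tensor A B -> C := tensor_lift (fun a b => f a * g b).

Fact tcopair_balanced : balanced (fun a b => f a * g b).
Proof.
split=> [a a' b|a b b'|c a b]; rewrite ?rmorphD ?mulrDl ?mulrDr //=.
by rewrite !linearZ -scalerAl -scalerAr.
Qed.

Lemma tcopairE a b : tcopair (tens a b) = f a * g b.
Proof. exact/tensor_lift_tens/tcopair_balanced. Qed.

Fact tcopair_zmod : zmod_morphism tcopair.
Proof.
move=> x y; apply/eqP; rewrite eq_sym subr_eq.
by rewrite -(tensor_liftD tcopair_balanced) subrK.
Qed.
HB.instance Definition _ :=
  GRing.isZmodMorphism.Build (tensor A B) C tcopair tcopair_zmod.

Fact tcopair_monoid : monoid_morphism tcopair.
Proof.
split=> [|x y]; first by rewrite tcopairE !rmorph1 mulr1.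
elim/tensor_ind: x => [|x x' IH IH'|a b].
- by rewrite !(mul0r, raddf0).
- by rewrite mulrDl !raddfD /= mulrDl IH IH'.
elim/tensor_ind: y => [|y y' IH IH'|a' b'].
- by rewrite !(mulr0, raddf0).
- by rewrite mulrDr !raddfD /= mulrDr IH IH'.
by rewrite -tensM !tcopairE !rmorphM mulrACA.
Qed.
HB.instance Definition _ :=
  GRing.isMonoidMorphism.Build (tensor A B) C tcopair tcopair_monoid.

Fact tcopair_scalable : scalable tcopair.
Proof.
move=> c x; rewrite -[c *: x]mulr_algl rmorphM /= -tensZl.
by rewrite tcopairE rmorph1 mulr1 linearZ rmorph1 mulr_algl.
Qed.
HB.instance Definition _ :=
  GRing.isScalable.Build k (tensor A B) C *:%R tcopair tcopair_scalable.
End TensorCopair.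

Definition tmap (k : fieldType) (A A' B B' : comAlgType k)
    (f : {lrmorphism A -> A'}) (g : {lrmorphism B -> B'}) :
    {lrmorphism tensor A B -> tensor A' B'} :=
  tcopair (tinl \o f) (tinr \o g).

Lemma tmapE (k : fieldType) (A A' B B' : comAlgType k)
    (f : {lrmorphism A -> A'}) (g : {lrmorphism B -> B'}) a b :
  tmap f g (tens a b) = tens (f a) (g b).
Proof. by rewrite /tmap /= tcopairE /= -tensE. Qed.

(* The derivation d_A (x) 1 + 1 (x) d_B.                                     *)
Section TensorDer.
Variables (k : diffFieldType) (A B : diffAlgType k).

Definition tensor_der : tensor A B -> tensor A B :=
  tensor_lift (fun a b => tens (der a) b + tens a (der b)).

Fact tensor_der_balanced :
  balanced (fun (a : A) (b : B) => tens (der a) b + tens a (der b)).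
Proof.
split=> [a a' b|a b b'|c a b].
- by rewrite derD !tensDl addrACA.
- by rewrite derD !tensDr addrACA.
- by rewrite !derZ tensDl tensDr !tensZ [RHS]addrA (addrC (tens (der a) _)).
Qed.

Lemma tensor_derE a b : tensor_der (tens a b) = tens (der a) b + tens a (der b).
Proof. exact/tensor_lift_tens/tensor_der_balanced. Qed.

Fact tensor_derD : {morph tensor_der : x y / x + y}.
Proof. exact/tensor_liftD/tensor_der_balanced. Qed.

Fact tensor_derM x y : tensor_der (x * y) = tensor_der x * y + x * tensor_der y.
Proof.
have d0 : tensor_der 0 = 0 by exact/tensor_lift0/tensor_der_balanced.
elim/tensor_ind: x => [|x x' IH IH'|a b].
- by rewrite !(mul0r, d0) addr0.
- by rewrite mulrDl !tensor_derD IH IH' !mulrDl addrACA.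
elim/tensor_ind: y => [|y y' IH IH'|a' b'].
- by rewrite !(mulr0, d0) addr0.
- by rewrite mulrDr !tensor_derD IH IH' !mulrDr addrACA.
rewrite -tensM !tensor_derE !derM tensDl tensDr mulrDl mulrDr -!tensM.
by rewrite addrACA.
Qed.
HB.instance Definition _ :=
  isDifferential.Build (tensor A B) tensor_derD tensor_derM.

Lemma der_tens (a : A) (b : B) :
  der (tens a b) = tens (der a) b + tens a (der b).
Proof. exact: tensor_derE. Qed.

Fact tensor_der_alg (c : k) : der (c%:A : tensor A B) = (der c)%:A.
Proof.
have E (d : k) : d%:A = tens d%:A 1 :> tensor A B by rewrite tensZl.
by rewrite !E der_tens der1 der_alg -[tens _ 0](addrK (tens c%:A 0)) -tensDr
  addr0 subrr addr0.
Qed.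
HB.instance Definition _ := isDiffAlgebra.Build k (tensor A B) tensor_der_alg.
End TensorDer.

(* [res A] is the F-algebra A viewed as an algebra over K = const F.         *)
Definition res (F : diffFieldType) (A : Type) : Type := A.
Arguments res {F} A.

Section Restriction.
Variables (F : diffFieldType) (A : comAlgType F).
Local Notation rA := (@res F A).

HB.instance Definition _ := GRing.ComNzRing.on rA.

Definition res_scale (c : const F) (x : rA) : rA := val c *: (x : A).

Fact res_scaleA c d x : res_scale c (res_scale d x) = res_scale (c * d) x.
Proof. exact: scalerA. Qed.
Fact res_scale1 : left_id 1 res_scale.
Proof. exact: scale1r. Qed.
Fact res_scaleDr : right_distributive res_scale +%R.
Proof. by move=> c x y; apply: scalerDr. Qed.
Fact res_scaleDl x : {morph res_scale^~ x : c d / c + d}.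
Proof. by move=> c d; apply: scalerDl. Qed.
HB.instance Definition _ := GRing.Zmodule_isLmodule.Build (const F) rA
  res_scaleA res_scale1 res_scaleDr res_scaleDl.
Fact res_scaleAl (c : const F) (x y : rA) : c *: (x * y) = (c *: x) * y.
Proof. exact: (@scalerAl F A). Qed.
HB.instance Definition _ := GRing.Lmodule_isLalgebra.Build (const F) rA
  res_scaleAl.
HB.instance Definition _ := GRing.Lalgebra_isComAlgebra.Build (const F) rA.
End Restriction.

Section RestrictionDer.
Variables (F : diffFieldType) (A : diffAlgType F).
Local Notation rA := (@res F A).
HB.instance Definition _ := isDifferential.Build rA (@derD A) (@derM A).
Fact res_der_alg (c : const F) : der (c%:A : rA) = (der c)%:A.
Proof. by rewrite [LHS](@der_alg F A) der_const !scale0r. Qed.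
HB.instance Definition _ := isDiffAlgebra.Build (const F) rA res_der_alg.
End RestrictionDer.

Section RestrictionMap.
Variables (F : diffFieldType) (A B : comAlgType F) (f : {lrmorphism A -> B}).
Definition res_fun : @res F A -> @res F B := f.
HB.instance Definition _ := GRing.RMorphism.copy res_fun f.
Fact res_fun_scalable : scalable res_fun.
Proof. by move=> c x; apply: (linearZ_LR f (val c) x). Qed.
HB.instance Definition _ := GRing.isScalable.Build (const F) (@res F A)
  (@res F B) *:%R res_fun res_fun_scalable.
Definition res_map : {lrmorphism @res F A -> @res F B} := res_fun.
End RestrictionMap.

(* [triv A] is the K-algebra A with the zero derivation (A constant).        *)
Definition triv (F : diffFieldType) (A : Type) : Type := A.
Arguments triv {F} A.

Section Trivial.
Variables (F : diffFieldType) (A : comAlgType (const F)).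
Local Notation tA := (@triv F A).
HB.instance Definition _ := GRing.ComAlgebra.on tA.
Fact triv_derD : {morph (fun=> 0) : x y / x + y :> tA}.
Proof. by move=> x y; rewrite addr0. Qed.
Fact triv_derM (x y : tA) : 0 = 0 * y + x * 0.
Proof. by rewrite mul0r mulr0 addr0. Qed.
HB.instance Definition _ := isDifferential.Build tA triv_derD triv_derM.
Fact triv_der_alg (c : const F) : der (c%:A : tA) = (der c)%:A.
Proof. by rewrite [RHS]scale0r. Qed.
HB.instance Definition _ := isDiffAlgebra.Build (const F) tA triv_der_alg.

Definition of_triv : {lrmorphism tA -> A} := idfun : A -> A.
Definition to_triv : {lrmorphism A -> tA} := idfun : A -> A.
End Trivial.

Definition triv_map (F : diffFieldType) (A B : comAlgType (const F))
  (f : {lrmorphism A -> B}) : {lrmorphism @triv F A -> @triv F B} := f.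

(* R (x)_K A with A constant                                                 *)
Notation cext R A := (tensor (res R) (triv A)).

(* F[G] = F (x)_K K[G], as a differential F-algebra, for H = K[G].           *)
Definition bext (F : diffFieldType) (H : comAlgType (const F)) : Type :=
  cext F^o H.

Section BaseExtension.
Variables (F : diffFieldType) (H : comAlgType (const F)).
Local Notation T := (cext F^o H).
Local Notation E := (bext H).

HB.instance Definition _ := DiffRing.copy E T.

Definition bext_scale (a : F) (x : T) : T := tinl (a : res F^o) * x.

Fact bext_scaleA a b x : bext_scale a (bext_scale b x) = bext_scale (a * b) x.
Proof. by rewrite /bext_scale mulrA -tensM mulr1. Qed.
Fact bext_scale1 : left_id 1 bext_scale.
Proof. by move=> x; rewrite /bext_scale mul1r. Qed.
Fact bext_scaleDr : right_distributive bext_scale +%R.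
Proof. by move=> c x y; rewrite /bext_scale mulrDr. Qed.
Fact bext_scaleDl x : {morph bext_scale^~ x : c d / c + d}.
Proof. by move=> c d; rewrite /bext_scale /tinl tensDl mulrDl. Qed.
HB.instance Definition _ := GRing.Zmodule_isLmodule.Build F E
  bext_scaleA bext_scale1 bext_scaleDr bext_scaleDl.
Fact bext_scaleAl (c : F) (x y : E) : c *: (x * y) = (c *: x) * y.
Proof. exact: (@mulrA T). Qed.
HB.instance Definition _ := GRing.Lmodule_isLalgebra.Build F E bext_scaleAl.
HB.instance Definition _ := GRing.Lalgebra_isComAlgebra.Build F E.
Fact bext_der_alg (c : F) : der (c%:A : E) = (der c)%:A.
Proof.
have Ea (d : F) : d%:A = tens (d : res F^o) (1 : triv H) :> E.
  by rewrite [LHS]mulr1.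
rewrite !Ea; apply: etrans (der_tens _ _) _.
by rewrite der1 -[tens _ 0](addrK (tens (c : res F^o) (0 : triv H))) -tensDr
  addr0 subrr addr0.
Qed.
HB.instance Definition _ := isDiffAlgebra.Build F E bext_der_alg.

Definition bext_fun : H -> @res F E := fun h => (tens 1 (h : triv H) : T).
HB.instance Definition _ := GRing.isZmodMorphism.Build H (@res F E) bext_fun
  (@tinr_zmod (const F) (res F^o) (triv H)).
HB.instance Definition _ := GRing.isMonoidMorphism.Build H (@res F E) bext_fun
  (@tinr_monoid (const F) (res F^o) (triv H)).
Fact bext_fun_scalable : scalable bext_fun.
Proof.
move=> c x.
have -> : c *: bext_fun x =
    (tens (val c : res F^o) 1 * tens 1 (x : triv H) : T).
  by [].
rewrite -tensM mulr1 mul1r /bext_fun [LHS](@tensZr _ _ (triv H)) -tensZl.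
by congr tens; rewrite [LHS]mulr1.
Qed.
HB.instance Definition _ := GRing.isScalable.Build (const F) H (@res F E)
  *:%R bext_fun bext_fun_scalable.
Definition bext_in : {lrmorphism H -> @res F E} := bext_fun.
End BaseExtension.

(* Leibniz equality of algebra maps is pointwise equality.                   *)
Lemma lrmorphism_eq (k : pzRingType) (A B : lalgType k)
  (f g : {lrmorphism A -> B}) : f =1 g -> f = g.
Proof.
move=> /funext; case: f g => [f [[f1] [f2] [f3]]] [g [[g1] [g2] [g3]]] /= E.
subst g; congr (GRing.LRMorphism.Pack (GRing.LRMorphism.Class _ _ _)).
- by congr (GRing.isNmodMorphism.Axioms_ _); apply: Prop_irrelevance.
- by congr (GRing.isMonoidMorphism.Axioms_ _); apply: Prop_irrelevance.
- by congr (GRing.isScalable.Axioms_ _); apply: Prop_irrelevance.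
Qed.

Definition generated (k : pzRingType) (A : lalgType k) (X : A -> Prop) : Prop :=
  forall S : {pred A}, GRing.subalg_closed S -> (forall x, X x -> x \in S) ->
  forall x, x \in S.

Definition finite_type (k : pzRingType) (A : lalgType k) : Prop :=
  exists s : seq A, generated (fun x => x \in s).

(* G = Spec K[G], given as a group-valued functor of points represented by   *)
(* the finitely generated algebra [coord_ring] = K[G].                       *)
Record linAlgGroup (K : fieldType) := LinAlgGroup {
  coord_ring : comAlgType K;
  coord_finite : finite_type coord_ring;
  gmul : forall A : comAlgType K,
    {lrmorphism coord_ring -> A} -> {lrmorphism coord_ring -> A} ->
    {lrmorphism coord_ring -> A};
  gone : forall A : comAlgType K, {lrmorphism coord_ring -> A};
  ginv : forall A : comAlgType K,
    {lrmorphism coord_ring -> A} -> {lrmorphism coord_ring -> A};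
  gmulA : forall A, associative (gmul (A := A));
  gmul1 : forall A, left_id (gone A) (gmul (A := A));
  gmulV : forall A, left_inverse (gone A) (ginv (A := A)) (gmul (A := A));
  gmul_natural : forall (A B : comAlgType K) (f : {lrmorphism A -> B})
    (g h : {lrmorphism coord_ring -> A}),
    f \o gmul g h =1 gmul (f \o g) (f \o h)
}.
Arguments gmul {K} G {A} : rename.
Arguments gone {K} G A : rename.
Arguments ginv {K} G {A} : rename.

Section Torsors.
Variables (F : diffFieldType) (G : linAlgGroup (const F)).

(* X(A) x G(A) -> X(A) for X = Spec R; G_F(A) = G(A), the points of G in the *)
(* K-algebra underlying A.                                                   *)
Definition action_on (R : comAlgType F) : Type :=
  forall A : comAlgType F, {lrmorphism R -> A} ->
    {lrmorphism coord_ring G -> @res F A} -> {lrmorphism R -> A}.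

Record is_right_action (R : comAlgType F) (act : action_on R) : Prop := {
  act1 : forall (A : comAlgType F) (x : {lrmorphism R -> A}),
    act A x (gone G _) = x;
  actM : forall (A : comAlgType F) (x : {lrmorphism R -> A})
    (g h : {lrmorphism coord_ring G -> @res F A}),
    act A (act A x g) h = act A x (gmul G g h);
  act_natural : forall (A B : comAlgType F) (f : {lrmorphism A -> B})
    (x : {lrmorphism R -> A}) (g : {lrmorphism coord_ring G -> @res F A}),
    f \o act A x g =1 act B (f \o x) (res_map f \o g)
}.

(* Spec R is nonempty because R, being a [comAlgType], is not the zero ring. *)
Record is_torsor (R : comAlgType F) (act : action_on R) : Prop := {
  torsor_finite : finite_type R;
  torsor_action : is_right_action act;
  torsor_unique : forall (A : comAlgType F) (x y : {lrmorphism R -> A}),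
    exists! g : {lrmorphism coord_ring G -> @res F A}, y = act A x g
}.

(* The comorphism F[X] -> F[X] (x)_F F[G] of the action, i.e. the product of *)
(* the two universal points.                                                 *)
Definition coaction (R : diffAlgType F) (act : action_on R) :
    {lrmorphism R -> tensor R (bext (coord_ring G))} :=
  act (tensor R (bext (coord_ring G))) tinl
    (res_map tinr \o bext_in (coord_ring G)).

Record is_diff_torsor (R : diffAlgType F) (act : action_on R) : Prop := {
  diff_torsor : is_torsor act;
  diff_coaction : forall r : R, coaction act (der r) = der (coaction act r)
}.
End Torsors.

(* [idealr_closed I] says that I is a proper ideal.                          *)
Definition diff_simple (R : diffRingType) : Prop :=
  forall I : {pred R}, idealr_closed I -> {in I, forall x, der x \in I} ->
  {in I, forall x, x = 0}.

Section PicardVessiot.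
Variable F : diffFieldType.

Record is_PV_ring (R : diffAlgType F) : Prop := {
  (* W = Z^-1, so \det W = (\det Z)^-1 *)
  PV_generated : exists (n : nat) (Z W : 'M[R]_n),
    [/\ Z *m W = 1%:M, W *m Z = 1%:M,
        exists A : 'M[F]_n, map_mx der Z *m W = map_mx (in_alg R) A &
        generated (fun r : R => (exists i j, r = Z i j) \/ r = \det W)];
  PV_simple : diff_simple R;
  PV_const : forall r : R,
    der r = 0 <-> exists c : const F, r = (val c)%:A
}.

Section AlgMap.
Variable R : comAlgType F.
Definition alg_fun : F^o -> R := in_alg R.
HB.instance Definition _ := GRing.RMorphism.copy alg_fun (in_alg R).
Fact alg_fun_scalable : scalable alg_fun.
Proof. by move=> c a; rewrite /alg_fun /= scalerA. Qed.
HB.instance Definition _ :=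
  GRing.isScalable.Build F F^o R *:%R alg_fun alg_fun_scalable.
Definition alg_map : {lrmorphism F^o -> R} := alg_fun.
End AlgMap.

Definition base_map (R : comAlgType F) (A : comAlgType (const F)) :
    {lrmorphism cext F^o A -> cext R A} :=
  tmap (res_map (alg_map R)) idfun.

Record diffAut (R : diffAlgType F) (A : comAlgType (const F)) := DiffAut {
  aut :> {rmorphism cext R A -> cext R A};
  aut_bij : bijective aut;
  aut_der : forall t, aut (der t) = der (aut t);
  aut_linear : forall u t, aut (base_map R A u * t) = base_map R A u * aut t
}.

(* An identification of the group functor Aut^d(R/F) with G: an isomorphism  *)
(* G(A) -> Aut^d(R/F)(A), natural in A.  For f : A -> B the automorphism of  *)
(* R (x) B induced by s in Aut^d(R/F)(A) is the only one which agrees with s *)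
(* along 1 (x) f.                                                            *)
Record galois_group (G : linAlgGroup (const F)) (R : diffAlgType F) :=
    GaloisGroup {
  gal : forall A : comAlgType (const F),
    {lrmorphism coord_ring G -> A} -> diffAut R A;
  gal_bij : forall A, bijective (gal (A := A));
  galM : forall (A : comAlgType (const F))
    (g h : {lrmorphism coord_ring G -> A}),
    gal (gmul G g h) =1 gal g \o gal h;
  gal_natural : forall (A B : comAlgType (const F)) (f : {lrmorphism A -> B})
    (g : {lrmorphism coord_ring G -> A}) (t : cext R A),
    gal (f \o g) (tmap idfun (triv_map f) t) =
    tmap idfun (triv_map f) (gal g t)
}.

(* The right action on Spec R corresponding to the left action of G on R:    *)
(* x.g is R -> R (x)_K A -- g --> R (x)_K A -- x (x) id --> A.               *)
Section GaloisAction.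
Variables (G : linAlgGroup (const F)) (R : diffAlgType F).
Variable theta : galois_group G R.
Variables (A : comAlgType F) (x : {lrmorphism R -> A}).
Variable g : {lrmorphism coord_ring G -> @res F A}.

Definition gal_act_fun (r : R) : A :=
  tcopair (res_map x) (of_triv (@res F A)) (gal theta g (tinl (r : res R))).

Let TR := cext R (@res F A).

Fact gal_act_zmod : zmod_morphism gal_act_fun.
Proof. by move=> r s; rewrite /gal_act_fun !raddfB. Qed.
HB.instance Definition _ :=
  GRing.isZmodMorphism.Build R A gal_act_fun gal_act_zmod.

Fact gal_act_monoid : monoid_morphism gal_act_fun.
Proof.
split=> [|r s]; rewrite /gal_act_fun.
  by rewrite !rmorph1.
by rewrite !rmorphM.
Qed.
HB.instance Definition _ :=
  GRing.isMonoidMorphism.Build R A gal_act_fun gal_act_monoid.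

Fact gal_act_scalable : scalable gal_act_fun.
Proof.
move=> a r; rewrite /gal_act_fun.
have -> : tinl (a *: r : res R) =
    base_map R (@res F A) (tinl (a : res F^o)) * tinl (r : res R) :> TR.
  rewrite tmapE -tensM mulr1; congr tens.
  exact: (esym (@mulr_algl F R a r)).
rewrite aut_linear rmorphM tmapE [X in X * _]tcopairE rmorph1 mulr1.
rewrite [X in X * _](rmorph_alg x); exact: (@mulr_algl F A).
Qed.
HB.instance Definition _ :=
  GRing.isScalable.Build F R A *:%R gal_act_fun gal_act_scalable.

End GaloisAction.

Definition gal_act (G : linAlgGroup (const F)) (R : diffAlgType F)
    (theta : galois_group G R) : action_on G R :=
  fun A x g => gal_act_fun theta x g.
End PicardVessiot.
Arguments gal_act {F G R} theta A x g.

(* Main.v *)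
Require Import Defs.
From HB Require Import structures.
From mathcomp Require Import all_boot all_order all_algebra.
From mathcomp Require Import boolp classical_sets.

(* (a) R (x)_F R is generated over R by its constants, the entries of
   (Z^-1 (x) 1)(1 (x) Z) and of its inverse, and these are linearly disjoint from
   R over K because R is simple with constants K.  Hence two points x, y of
   Spec R in A yield exactly one differential map R -> R (x)_K A whose
   composite with x is y; it extends to an automorphism of R (x)_K A, with
   inverse given by (y, x).

   (b) The torsor property makes R (x)_F R differentially isomorphic to
   R (x)_K K[G].  Differential submodules of the latter are, up to denominators,
   spanned by subspaces of K[G], which yields simplicity.  For f in R with
   coaction \sum a_i (x) h_i, the h_i independent over K, the derivatives of the
   a_i span a matrix of finite rank n, so f satisfies a linear differential
   equation of order n over F, which the a_i also solve.  A nonvanishing n x n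
   Wronskian of some a_i is the determinant of a fundamental matrix, which is
   invertible over R by simplicity, and f is a K-combination of the entries of
   its first row. *)

Set Implicit Arguments.
Unset Strict Implicit.
Unset Printing Implicit Defensive.

Import GRing.Theory.
Local Open Scope ring_scope.

(** * Linear functionals and tensor products over a field *)

Definition subspace (k : fieldType) (V : lmodType k) (U : V -> Prop) : Prop :=
  U 0 /\ forall (c : k) v w, U v -> U w -> U (c *: v + w).

Section Subspace.
Variables (k : fieldType) (V : lmodType k) (U : V -> Prop).
Hypothesis sU : subspace U.

Lemma subspaceD v w : U v -> U w -> U (v + w).
Proof. by case: sU => _ UZ Uv Uw; rewrite -[v]scale1r; apply: UZ. Qed.

Lemma subspaceZ c v : U v -> U (c *: v).
Proof. by case: sU => U0 UZ Uv; rewrite -[_ *: _]addr0; apply: UZ. Qed.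

(* Zorn gives a subspace [W] maximal among those with [a] outside [W + U];
   then [W] contains [U] and, modulo [W], every vector is a multiple of [a]. *)
Lemma separating_functional (a : V) : ~ U a ->
  exists phi : {scalar V}, (forall u, U u -> phi u = 0) /\ phi a = 1.
Proof.
move=> nUa; have U0 := sU.1.
pose P (W : set V) := (forall c v w, W v -> W w -> W (c *: v + w)) /\
   forall w, W w -> ~ U (a - w).
have [FF FP FT|W [[WL Wa] Wmax]] := @Zorn_bigcup V P.
  split=> [c v w [X FX Xv] [Y FY Yw]|w [X FX Xw]]; last first.
    by have [_] := FP _ FX; apply.
  have [XY|YX] := FT _ _ FX FY.
    by exists Y => //; have [+ _] := FP _ FY; apply => //; apply: XY.
  by exists X => //; have [+ _] := FP _ FX; apply => //; apply: YX.
have W0 : W 0.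
  have [[v Wv]|nW] := pselect (exists v, W v).
    by rewrite -(subrr v) addrC -scaleN1r; apply: WL.
  case: (Wmax (fun w => w = 0)).
    split=> [v Wv|sub]; first by case: nW; exists v.
    by apply: nW; exists 0; apply: sub.
  split=> [c v w -> ->|w ->]; first by rewrite scaler0 addr0.
  by rewrite subr0.
have WZ c v : W v -> W (c *: v) by move=> Wv; rewrite -[_ *: _]addr0; apply: WL.
have WD v w : W v -> W w -> W (v + w).
  by move=> Wv Ww; rewrite -[v]scale1r; apply: WL.
have WN v : W v -> W (- v) by rewrite -scaleN1r; apply: WZ.
have step v : ~ W v -> exists c w, W w /\ U (a - (c *: v + w)).
  move=> nWv; apply: contrapT => nE.
  apply: (Wmax (fun x => exists c w, W w /\ x = c *: v + w)).
    split=> [w Ww|sub]; first by exists 0, w; rewrite scale0r add0r.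
    by apply/nWv/sub; exists 1, 0; rewrite scale1r addr0.
  split=> [c _ _ [d [w [Ww ->]]] [e [x [Wx ->]]]|_ [c [w [Ww ->]]] Uw].
    exists (c * d + e), (c *: w + x); split; first exact: WL.
    by rewrite scalerDr scalerA scalerDl addrACA.
  by apply: nE; exists c, w.
have UW u : U u -> W u.
  move=> Uu; apply: contrapT => /step [c [w [/Wa nU Uw]]]; apply: nU.
  have -> : a - w = a - (c *: u + w) + c *: u.
    by rewrite opprD addrA addrAC subrK.
  exact/subspaceD/subspaceZ.
have dec v : exists c : k, W (v - c *: a).
  have [Wv|/step [c [w [Ww Uw]]]] := pselect (W v).
    by exists 0; rewrite scale0r subr0.
  have c0 : c != 0.
    by apply/eqP => c0; move: Uw; rewrite c0 scale0r add0r; apply: Wa.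
  exists c^-1.
  have -> : v - c^-1 *: a = c^-1 *: (- (a - (c *: v + w)) - w).
    by rewrite opprB addrAC addrK scalerBr scalerA mulVf // scale1r.
  by apply/WZ/WD; apply: WN => //; apply: UW.
have nWa : ~ W a by move=> /Wa; rewrite subrr.
have uniq v c d : W (v - c *: a) -> W (v - d *: a) -> c = d.
  move=> Wc Wd; apply/eqP; rewrite -subr_eq0; apply/eqP/eqP.
  apply: contra_notT nWa => cd.
  rewrite -[a](scale1r a) -(mulVf cd) -scalerA; apply: WZ.
  have -> : (c - d) *: a = (v - d *: a) + - (v - c *: a).
    by rewrite opprB [RHS]addrC addrA subrK scalerBl.
  exact/WD/WN.
pose phi v := sval (cid (dec v)).
have phiP v : W (v - phi v *: a) by rewrite /phi; case: cid.
have phiL : linear_for *%R phi.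
  move=> c v w; apply: uniq (phiP _) _.
  have -> : c *: v + w - (c * phi v + phi w) *: a =
      c *: (v - phi v *: a) + (w - phi w *: a).
    by rewrite scalerDl opprD addrACA scalerBr scalerA.
  exact: WL.
pose phi_lin := GRing.isLinear.Build k V k *%R phi phiL.
pose phi_pack : {scalar V} := HB.pack phi phi_lin.
exists phi_pack; split=> [u Uu|].
  by apply: uniq (phiP _) _; rewrite scale0r subr0; apply: UW.
by apply: uniq (phiP _) _; rewrite scale1r subrr.
Qed.

End Subspace.

(** * Slices of a tensor along functionals on the second factor *)

Section TensorSlice.
Variables (k : fieldType) (A B : comAlgType k).
Implicit Types (t : tensor A B) (J : B -> Prop).

Lemma tens0l (b : B) : tens 0 b = 0 :> tensor A B.
Proof. by have := tensZl 0 (0 : A) b; rewrite !scale0r. Qed.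

Lemma tens0r (a : A) : tens a 0 = 0 :> tensor A B.
Proof. by have := tensZr 0 a (0 : B); rewrite !scale0r. Qed.

(** The map id (x) psi, with A (x) k read as A. Slices along functionals killing [J] detect
    membership in A (x) J. *)
Definition slice (psi : {scalar B}) : tensor A B -> A :=
  tensor_lift (fun a b => psi b *: a).

Fact slice_balanced (psi : {scalar B}) :
  balanced (fun a b => psi b *: (a : A)).
Proof.
split=> [a a' b|a b b'|c a b]; first by rewrite scalerDr.
  by rewrite linearD scalerDl.
by rewrite scalerA [psi (c *: b)]linearZ mulrC.
Qed.

Lemma sliceE psi a b : slice psi (tens a b) = psi b *: a.
Proof. exact/tensor_lift_tens/slice_balanced. Qed.

Fact slice_zmod psi : zmod_morphism (slice psi).
Proof.
move=> x y; apply/eqP; rewrite eq_sym subr_eq.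
by rewrite -(tensor_liftD (slice_balanced psi)) subrK.
Qed.
HB.instance Definition _ psi :=
  GRing.isZmodMorphism.Build (tensor A B) A (slice psi) (slice_zmod psi).

Lemma slice_tinlM psi a t : slice psi (tinl a * t) = a * slice psi t.
Proof.
elim/tensor_ind: t => [|x y IHx IHy|a' b]; first by rewrite mulr0 raddf0 mulr0.
  by rewrite mulrDr !raddfD /= IHx IHy mulrDr.
by rewrite -tensM mul1r !sliceE scalerAr.
Qed.

Inductive tspan J : tensor A B -> Prop :=
| tspan0 : tspan J 0
| tspanD t t' : tspan J t -> tspan J t' -> tspan J (t + t')
| tspan_tens a b : J b -> tspan J (tens a b).

Lemma tspan_tinlM J a t : tspan J t -> tspan J (tinl a * t).
Proof.
elim=> [|x y _ IHx _ IHy|a' b Jb]; first by rewrite mulr0; apply: tspan0.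
  by rewrite mulrDr; apply: tspanD.
by rewrite -tensM mul1r; apply: tspan_tens.
Qed.

Lemma tspanN J t : tspan J t -> tspan J (- t).
Proof.
move=> Jt; rewrite -mulN1r -(rmorphN1 (@tinl k A B)); exact: tspan_tinlM.
Qed.

Lemma tspanB J t t' : tspan J t -> tspan J t' -> tspan J (t - t').
Proof. by move=> Jt Jt'; apply/tspanD/tspanN. Qed.

Lemma tspanM J t t' : (forall b b', J b -> J b' -> J (b * b')) ->
  tspan J t -> tspan J t' -> tspan J (t * t').
Proof.
move=> JM Jt Jt'; elim: Jt => [|x y _ Jx _ Jy|a b Jb].
- by rewrite mul0r; apply: tspan0.
- by rewrite mulrDl; apply: tspanD.
elim: Jt' => [|x y _ Jx _ Jy|a' b' Jb']; first by rewrite mulr0; apply: tspan0.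
  by rewrite mulrDr; apply: tspanD.
by rewrite -tensM; apply/tspan_tens/JM.
Qed.

Lemma slice_tspan J (psi : {scalar B}) t : (forall b, J b -> psi b = 0) ->
  tspan J t -> slice psi t = 0.
Proof.
move=> psiJ; elim=> [|x y _ Jx _ Jy|a b Jb]; first by rewrite raddf0.
  by rewrite raddfD /= Jx Jy addr0.
by rewrite sliceE psiJ // scale0r.
Qed.

(* Induction on the length of [t = \sum a_i (x) b_i], with [J] replaced by
   [J + k.b_1] so that the first summand can be dropped. *)
Lemma tensor_split J (l : A) t : subspace J ->
  (forall psi : {scalar B}, (forall b, J b -> psi b = 0) ->
     exists c : k, slice psi t = c *: l) ->
  exists b, tspan J (t - tens l b).
Proof.
rewrite -[t]tclassK; move: {t}(repr t) => s.
elim: s J => [|[a1 b1] s IHs] J sJ H.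
  exists 0; rewrite (_ : tclass [::] = 0) // sub0r tens0r oppr0; exact: tspan0.
have tE : tclass ((a1, b1) :: s) = tens a1 b1 + tclass s.
  by rewrite -cat1s tclass_cat.
pose J1 b := exists c, J (b - c *: b1).
have sJ1 : subspace J1.
  split=> [|c v w [d Jv] [e Jw]].
    by exists 0; rewrite scale0r subr0; case: sJ.
  exists (c * d + e).
  rewrite (_ : _ - _ = c *: (v - d *: b1) + (w - e *: b1)); first exact: sJ.2.
  by rewrite scalerBr scalerA scalerDl opprD addrACA.
have JJ1 b : J b -> J1 b by move=> Jb; exists 0; rewrite scale0r subr0.
have J1b1 : J1 b1 by exists 1; rewrite scale1r subrr; case: sJ.
have [psi psiJ1|b tb] := IHs J1 sJ1.
  have [|c] := H psi; first by move=> b /JJ1 /psiJ1.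
  by rewrite tE raddfD /= sliceE psiJ1 // scale0r add0r => ->; exists c.
have {}tb : tspan J1 (tclass ((a1, b1) :: s) - tens l b).
  by rewrite tE -addrA; apply: tspanD tb; apply: tspan_tens.
(* Modulo [J], the space [J1] is the line of [b1], so passing from [J1] to [J] costs a single term a
   (x) b1. *)
have [a Ja] : exists a,
    tspan J (tclass ((a1, b1) :: s) - tens l b - tens a b1).
  elim: tb => [|x y _ [a Jx] _ [a' Jy]|a c [d Jd]].
  - by exists 0; rewrite tens0l subrr; apply: tspan0.
  - by exists (a + a'); rewrite tensDl opprD addrACA; apply: tspanD.
  - exists (d *: a); rewrite tensZ -[c in tens a c](subrK (d *: b1)) tensDr addrK.
    exact: tspan_tens.
(* If [b1] lies outside [J], a functional killing [J] with value 1 at [b1] shows that [a] is the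
   multiple [c - psi b] of [l], so a (x) b1 merges with l (x) b. *)
have [Jb1|/(separating_functional sJ) [psi [psiJ psib1]]] := pselect (J b1).
  exists b; rewrite -[X in tspan _ X](subrK (tens a b1)).
  by apply: tspanD => //; apply: tspan_tens.
have [c] := H psi psiJ; have := slice_tspan psiJ Ja.
rewrite !raddfB /= !sliceE psib1 scale1r => /eqP; rewrite subr_eq0 => /eqP aE cE.
exists (b + (c - psi b) *: b1); rewrite tensDr opprD addrA.
by rewrite -tensZ scalerBl -cE aE.
Qed.

(** The case [l = 0] of [tensor_split]. *)
Lemma tspanP J t : subspace J ->
  (forall psi : {scalar B}, (forall b, J b -> psi b = 0) -> slice psi t = 0) ->
  tspan J t.
Proof.
move=> sJ H; have [psi /H ->|b] := @tensor_split J 0 t sJ.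
  by exists 0; rewrite scaler0.
by rewrite tens0l subr0.
Qed.

Lemma tinr_inj : injective (@tinr k A B).
Proof.
move=> b b' E; apply/eqP; rewrite -subr_eq0; apply/eqP.
apply: contrapT => nE.
have [|phi [_ phi1]] := @separating_functional _ _ (fun b : B => b = 0) _ _ nE.
  by split=> // c v w -> ->; rewrite scaler0 addr0.
have := congr1 (slice phi) E; rewrite !sliceE => /eqP.
by rewrite -subr_eq0 -scalerBl -raddfB /= phi1 scale1r oner_eq0.
Qed.

End TensorSlice.

Section TensorDerivation.
Variables (k : diffFieldType) (A B : diffAlgType k).

Lemma der_tinl (a : A) : der (tinl a : tensor A B) = tinl (der a).
Proof. by rewrite der_tens der1 tens0r addr0. Qed.

Lemma der_tinr (b : B) : der (tinr b : tensor A B) = tinr (der b).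
Proof. by rewrite der_tens der1 tens0l add0r. Qed.
End TensorDerivation.

(** * Scalar extension of a differential algebra by a constant algebra *)

(* [lext R B] is R (x)_K B with its F-algebra structure coming from R. *)
Definition lext (F : diffFieldType) (R : diffAlgType F)
  (B : comAlgType (const F)) : Type := cext R B.

Section LeftExtension.
Variables (F : diffFieldType) (R : diffAlgType F) (B : comAlgType (const F)).
Local Notation T := (cext R B).
Local Notation E := (lext R B).

HB.instance Definition _ := DiffRing.copy E T.

Definition lext_scale (a : F) (x : T) : T := tinl (a%:A : res R) * x.

Fact lext_scaleA a b x : lext_scale a (lext_scale b x) = lext_scale (a * b) x.
Proof.
rewrite /lext_scale mulrA -tensM mulr1; congr (tens _ _ * x).
by rewrite -[X in X = _]/((a%:A : R) * b%:A) -scalerAl mul1r scalerA.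
Qed.
Fact lext_scale1 : left_id 1 lext_scale.
Proof.
by move=> x; rewrite /lext_scale -[X in tinl X]/(1%:A : R) scale1r mul1r.
Qed.
Fact lext_scaleDr : right_distributive lext_scale +%R.
Proof. by move=> c x y; rewrite /lext_scale mulrDr. Qed.
Fact lext_scaleDl x : {morph lext_scale^~ x : c d / c + d}.
Proof.
move=> c d; rewrite /lext_scale -[X in tinl X * _ = _]/((c + d)%:A : R).
by rewrite scalerDl /tinl (@tensDl _ (res R)) mulrDl.
Qed.
HB.instance Definition _ := GRing.Zmodule_isLmodule.Build F E
  lext_scaleA lext_scale1 lext_scaleDr lext_scaleDl.
Fact lext_scaleAl (c : F) (x y : E) : c *: (x * y) = (c *: x) * y.
Proof. exact: (@mulrA T). Qed.
HB.instance Definition _ := GRing.Lmodule_isLalgebra.Build F E lext_scaleAl.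
HB.instance Definition _ := GRing.Lalgebra_isComAlgebra.Build F E.

Lemma lextZE (a : F) (t : E) : a *: t = (tinl (a%:A : res R) : T) * t.
Proof. by []. Qed.

Lemma der_tens_triv (a : res R) (b : triv B) :
  der (tens a b : T) = tens (der a) b.
Proof. by rewrite der_tens [X in _ + X]tens0r addr0. Qed.

Fact lext_der_alg (c : F) : der (c%:A : E) = (der c)%:A.
Proof.
rewrite !lextZE !mulr1 [LHS]der_tens_triv; congr tens.
exact: (der_alg c).
Qed.
HB.instance Definition _ := isDiffAlgebra.Build F E lext_der_alg.

Definition lext_inl_fun : R -> E := fun r => tinl (r : res R).
HB.instance Definition _ := GRing.isZmodMorphism.Build R E lext_inl_fun
  (@tinl_zmod (const F) (res R) (triv B)).
HB.instance Definition _ := GRing.isMonoidMorphism.Build R E lext_inl_fun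
  (@tinl_monoid (const F) (res R) (triv B)).
Fact lext_inl_scalable : scalable lext_inl_fun.
Proof.
move=> c x; rewrite lextZE -tensM mulr1; congr tens.
by rewrite -[RHS]/((c%:A : R) * x) mulr_algl.
Qed.
HB.instance Definition _ := GRing.isScalable.Build F R E
  *:%R lext_inl_fun lext_inl_scalable.
Definition lext_inl : {lrmorphism R -> E} := lext_inl_fun.

Definition lext_inr_fun : B -> @res F E := fun b => tinr (b : triv B).
HB.instance Definition _ := GRing.isZmodMorphism.Build B (@res F E) lext_inr_fun
  (@tinr_zmod (const F) (res R) (triv B)).
HB.instance Definition _ := GRing.isMonoidMorphism.Build B (@res F E)
  lext_inr_fun (@tinr_monoid (const F) (res R) (triv B)).
Fact lext_inr_scalable : scalable lext_inr_fun.
Proof.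
move=> c x; rewrite [LHS](@tinr_scalable _ (res R) (triv B)).
by rewrite -[LHS]mulr_algl -[in LHS]tensZl.
Qed.
HB.instance Definition _ := GRing.isScalable.Build (const F) B (@res F E)
  *:%R lext_inr_fun lext_inr_scalable.
Definition lext_inr : {lrmorphism B -> @res F E} := lext_inr_fun.

Lemma lext_ind (P : E -> Prop) :
  (forall x y, P x -> P y -> P (x + y)) ->
  (forall r b, P (lext_inl r * lext_inr b)) -> forall t, P t.
Proof.
move=> PD Pt; elim/tensor_ind => [||a b]; last by rewrite tensE; apply: Pt.
  by have := Pt 0 0; rewrite raddf0 mul0r.
exact: PD.
Qed.

Lemma der_lext_inl (r : R) : der (lext_inl r) = lext_inl (der r).
Proof. exact: der_tens_triv. Qed.

Lemma der_lext_inr (b : B) : der (lext_inr b : E) = 0.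
Proof. by rewrite [LHS]der_tens_triv der1 tens0l. Qed.

Lemma lext_inr_inj : injective lext_inr.
Proof. exact: (@tinr_inj _ (res R) (triv B)). Qed.

Section Copair.
Variables (A : comAlgType F) (f : {lrmorphism R -> A}).
Variable g : {lrmorphism B -> @res F A}.

(** [tcopair] is only K-linear; the F-structure carried by the left factor upgrades it to an
    F-algebra map, the universal property of R (x)_K B. *)
Definition lcopair_fun : E -> A := tcopair (res_map f) (g \o of_triv B).
HB.instance Definition _ := GRing.RMorphism.copy lcopair_fun
  (tcopair (res_map f) (g \o of_triv B)).

Lemma lcopair_funE r b :
  lcopair_fun (lext_inl r * lext_inr b) = f r * (g b : A).
Proof.
rewrite (_ : lext_inl r * lext_inr b = tens (r : res R) (b : triv B)).
  exact: (@tcopairE _ (res R) (triv B) (res A) (res_map f) (g \o of_triv B)).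
by rewrite tensE.
Qed.

Fact lcopair_scalable : scalable lcopair_fun.
Proof.
move=> c t; rewrite lextZE rmorphM /= [X in X * _]tcopairE rmorph1 mulr1.
rewrite -[X in X * _]/(f c%:A) rmorph_alg; exact: mulr_algl.
Qed.
HB.instance Definition _ := GRing.isScalable.Build F E A
  *:%R lcopair_fun lcopair_scalable.
Definition lcopair : {lrmorphism E -> A} := lcopair_fun.

Lemma lcopair_inl r : lcopair (lext_inl r) = f r.
Proof.
rewrite -[lext_inl r]mulr1 -(rmorph1 lext_inr) [LHS]lcopair_funE.
by rewrite rmorph1 mulr1.
Qed.

Lemma lcopair_inr b : lcopair (lext_inr b : E) = g b.
Proof.
rewrite -[X in lcopair X]mul1r -(rmorph1 lext_inl) [LHS]lcopair_funE.
by rewrite rmorph1 mul1r.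
Qed.
End Copair.

Lemma lext_eq (A : comPzRingType) (u v : {rmorphism E -> A}) :
  (forall r, u (lext_inl r) = v (lext_inl r)) ->
  (forall b, u (lext_inr b : E) = v (lext_inr b : E)) -> u =1 v.
Proof.
move=> uvl uvr; elim/lext_ind => [x y IHx IHy|r b].
  by rewrite !rmorphD IHx IHy.
by rewrite !rmorphM /= uvl uvr.
Qed.

Lemma lext_der (A : diffRingType) (u : {rmorphism E -> A}) :
  (forall r, u (der (lext_inl r)) = der (u (lext_inl r))) ->
  (forall b, der (u (lext_inr b : E)) = 0) ->
  forall t, u (der t) = der (u t).
Proof.
move=> ul ur; elim/lext_ind => [x y IHx IHy|r b].
  by rewrite derD !rmorphD derD /= IHx IHy.
by rewrite derM der_lext_inr mulr0 addr0 !rmorphM derM /= ul ur mulr0 addr0.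
Qed.
End LeftExtension.

(** * Differential submodules of R (x)_K B are spanned by subspaces of B *)

Section ConstantSpan.
Variables (F : diffFieldType) (R : diffAlgType F) (B : comAlgType (const F)).
Local Notation T := (cext R B).

(** The list [hs] need not be independent: its length is the induction measure, and recursion on it
    exposes a leading coefficient. *)
Fixpoint coef_span (hs : seq (triv B)) (t : T) : Prop :=
  if hs is h :: hs' then exists a t', t = tens a h + t' /\ coef_span hs' t'
  else t = 0.

Lemma coef_span_ex t : exists hs, coef_span hs t.
Proof.
rewrite -[t]tclassK; elim: (repr t) => [|[a b] s [hs IH]]; first by exists [::].
exists (b :: hs), a, (tclass s); split=> //.
by rewrite -cat1s tclass_cat.
Qed.

Lemma coef_span_comb hs a b t t' : coef_span hs t -> coef_span hs t' ->
  coef_span hs (tinl a * t + tinl b * t').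
Proof.
elim: hs t t' => [|h hs IH] t t' /=; first by move=> -> ->; rewrite !mulr0 addr0.
move=> [c [u [-> Hu]]] [d [v [-> Hv]]].
exists (a * c + b * d), (tinl a * u + tinl b * v); split; last exact: IH.
by rewrite !mulrDr -!tensM !mul1r tensDl addrACA.
Qed.

Lemma coef_span_der hs t : coef_span hs t -> coef_span hs (der t).
Proof.
elim: hs t => [|h hs IH] t /=; first by move=> ->; rewrite der0.
move=> [c [u [-> Hu]]]; exists (der c), (der u); split; last exact: IH.
by rewrite derD der_tens_triv.
Qed.

Lemma slice_der (psi : {scalar triv B}) (t : T) :
  slice psi (der t) = der (slice psi t).
Proof.
elim/tensor_ind: t => [|x y IHx IHy|a b]; first by rewrite der0 raddf0 der0.
  by rewrite derD !raddfD /= IHx IHy -derD.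
by rewrite der_tens_triv !sliceE derZ scale0r add0r.
Qed.

Variables (M : R -> Prop) (N : T -> Prop).
Hypothesis M_reg : forall l x, M l -> l * x = 0 -> x = 0.
Hypothesis M_const : forall a l : R, M l -> der a * l = a * der l ->
  exists c : const F, a = val c *: l.
Hypothesis M_ideal : forall I : R -> Prop,
  (forall a b x y, I x -> I y -> I (a * x + b * y)) ->
  (forall x, I x -> I (der x)) -> (exists2 x, I x & x != 0) ->
  exists2 l, I l & M l.
Hypothesis N_comb : forall a b t t', N t -> N t' -> N (tinl a * t + tinl b * t').
Hypothesis N_der : forall t, N t -> N (der t).
Hypothesis N_sat : forall l t, M l -> N (tinl (l : res R) * t) -> N t.
Hypothesis N0 : N 0.

(* The relation [l * der t1 - der l * t1] removes the leading coefficient [l]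
   of [t1]; by induction it lies in the span, so all slices of [t1] are
   constant multiples of [l]. *)
Lemma diff_submodule_const_span (t : T) :
  N t -> tspan (fun b => N (tens 1 b)) t.
Proof.
set J := fun b => _.
have NZ a u : N u -> N (tinl a * u).
  by move=> Nu; have := N_comb a 0 Nu Nu; rewrite raddf0 mul0r addr0.
have ND u v : N u -> N v -> N (u + v).
  by move=> Nu Nv; have := N_comb 1 1 Nu Nv; rewrite rmorph1 !mul1r.
have sJ : subspace J.
  split=> [|c v w Jv Jw]; first by rewrite /J tens0r.
  rewrite /J tensDr -tensZ -[_ *: _]mulr1 -[v]mul1r tensM; exact/ND/Jw/NZ.
have spanN u : tspan J u -> N u.
  elim=> [//|x y _ Nx _ Ny|a b Jb]; first exact: ND.
  by rewrite -[a]mulr1 -[b]mul1r tensM; apply: NZ.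
have [hs] := coef_span_ex t; elim: hs t => [|h hs IH] t /=.
  by move=> -> _; apply: tspan0.
move=> [l0 [t' [tE Ht']]] Nt.
have [l00|l0n] := eqVneq l0 0.
  by move: tE Nt; rewrite l00 tens0l add0r => -> ; apply: IH.
(* The possible coefficients of [h] in elements of [N] form a nonzero differential ideal, so one of
   them lies in [M]. *)
pose I (a : R) := exists2 u, coef_span hs u & N (tens (a : res R) h + u).
have [||| l [u Hu Nl] Ml] := @M_ideal I.
- move=> a b x y [u Hu Nu] [v Hv Nv].
  exists (tinl (a : res R) * u + tinl (b : res R) * v).
    exact: coef_span_comb.
  rewrite (_ : _ + _ = tinl (a : res R) * (tens (x : res R) h + u) +
    tinl (b : res R) * (tens (y : res R) h + v)); first exact: N_comb.
  by rewrite !mulrDr -!tensM !mul1r (@tensDl _ (res R)) addrACA.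
- move=> x [u Hu Nu]; exists (der u); first exact: coef_span_der.
  by rewrite -der_tens_triv -derD; apply: N_der.
- by exists l0 => //; exists t' => //; rewrite -tE.
set t1 := tens (l : res R) h + u in Nl.
have J1 : tspan J t1.
  have H2 : tspan J (tinl (l : res R) * der t1 + tinl (- der l : res R) * t1).
    apply: IH; last by apply: N_comb => //; apply: N_der.
    rewrite (_ : _ + _ = tinl (l : res R) * der u + tinl (- der l : res R) * u).
      by apply: coef_span_comb => //; apply: coef_span_der.
    rewrite /t1 derD der_tens_triv !mulrDr -!tensM !mul1r addrACA.
    rewrite -(@tensDl _ (res R)) mulNr mulrC [X in tens X]subrr.
    by rewrite tens0l add0r.
  have [psi psiJ|b Hb] := @tensor_split _ (res R) (triv B) J (l : res R) t1 sJ.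
    have [c cE] : exists c : const F, slice psi t1 = val c *: (l : R).
      apply: M_const => //; have := slice_tspan psiJ H2.
      rewrite raddfD /= !slice_tinlM slice_der mulNr => /eqP.
      by rewrite subr_eq0 mulrC => /eqP -> ; rewrite mulrC.
    by exists c.
  rewrite -[t1](subrK (tens (l : res R) b)); apply: tspanD => //.
  (* l (x) b differs from [t1] by an element of the span, so it lies in [N]; saturation cancels
     [l]. *)
  apply: tspan_tens; apply: (N_sat Ml); rewrite -tensM mulr1 mul1r.
  rewrite -[tens _ _](subKr t1); apply: ND => //.
  by rewrite -mulN1r -(rmorphN1 tinl); apply/NZ/spanN.
(* The coefficients of [h] cancel again, now between [t] and [t1]. Hence [l] annihilates each slice
   of [t] along a functional killing [J], and [l] is regular. *)
have H3 : tspan J (tinl (l : res R) * t + tinl (- l0) * t1).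
  apply: IH; last exact: N_comb.
  rewrite (_ : _ + _ = tinl (l : res R) * t' + tinl (- l0 : res R) * u).
    exact: coef_span_comb.
  rewrite tE /t1 !mulrDr -!tensM !mul1r addrACA -(@tensDl _ (res R)) mulNr.
  by rewrite mulrC [X in tens X]subrr tens0l add0r.
apply: tspanP => // psi psiJ; apply: (M_reg Ml).
have := slice_tspan psiJ H3; rewrite raddfD /= !slice_tinlM.
by rewrite (slice_tspan psiJ J1) mulr0 addr0.
Qed.
End ConstantSpan.

Section LextSpan.
Variables (F : diffFieldType) (R : diffAlgType F) (B : comAlgType (const F)).
Local Notation E := (lext R B).
Local Notation inl := (lext_inl R B).
Local Notation inr := (lext_inr R B).

Inductive lspan (J : B -> Prop) : E -> Prop :=
| lspan0 : lspan J 0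
| lspanD t t' : lspan J t -> lspan J t' -> lspan J (t + t')
| lspan_mul r b : J b -> lspan J (inl r * inr b).

Lemma tens_inlr (r : R) (b : B) :
  tens (r : res R) (b : triv B) = inl r * inr b :> E.
Proof. by rewrite tensE. Qed.

Lemma lspanE J (t : E) : lspan J t <-> tspan (J : triv B -> Prop) t.
Proof.
split; elim=> [|x y _ IHx _ IHy|r b Jb].
- exact: tspan0.
- exact: tspanD.
- by rewrite -tens_inlr; apply: tspan_tens.
- exact: lspan0.
- exact: lspanD.
- by rewrite tens_inlr; apply: lspan_mul.
Qed.

Lemma lspan_inlM J r t : lspan J t -> lspan J (inl r * t).
Proof. by move=> /lspanE Jt; apply/lspanE/tspan_tinlM. Qed.

Lemma lspanB J t t' : lspan J t -> lspan J t' -> lspan J (t - t').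
Proof. by move=> /lspanE Jt /lspanE Jt'; apply/lspanE/tspanB. Qed.

Lemma lspanM J t t' : (forall b b', J b -> J b' -> J (b * b')) ->
  lspan J t -> lspan J t' -> lspan J (t * t').
Proof. by move=> JM /lspanE Jt /lspanE Jt'; apply/lspanE/tspanM. Qed.

Lemma lspan_inr J b : J b -> lspan J (inr b).
Proof.
by move=> Jb; rewrite -[X in lspan _ X]mul1r -(rmorph1 inl); apply: lspan_mul.
Qed.

Lemma lspan_inl J r : J 1 -> lspan J (inl r).
Proof. by move=> J1; rewrite -[inl r]mulr1 -(rmorph1 inr); apply: lspan_mul. Qed.

Lemma der_lext_mul r b : der (inl r * inr b) = inl (der r) * inr b.
Proof. by rewrite derM der_lext_inl der_lext_inr mulr0 addr0. Qed.

Lemma lspan_der J t : lspan J t -> lspan J (der t).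
Proof.
elim=> [|x y _ IHx _ IHy|r b Jb]; first by rewrite der0; apply: lspan0.
  by rewrite derD; apply: lspanD.
by rewrite der_lext_mul; apply: lspan_mul.
Qed.

Lemma lspan_null J t : (forall b, J b -> b = 0) -> lspan J t -> t = 0.
Proof.
move=> J0; elim=> [//|x y _ -> _ ->|r b /J0 ->]; first by rewrite addr0.
by rewrite raddf0 mulr0.
Qed.

(** The slice along a functional killing [J] with value 1 at 1 returns [r]. *)
Lemma lspan_inl_eq0 J r : subspace J -> ~ J 1 -> lspan J (inl r) -> r = 0.
Proof.
move=> sJ /(separating_functional sJ) [phi [phiJ phi1]] /lspanE.
move=> /(@slice_tspan _ (res R) (triv B) _ phi) H; have := H phiJ.
by rewrite [LHS]sliceE [X in X *: _]phi1 scale1r.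
Qed.

Hypothesis constR : forall r : R, der r = 0 -> exists c : const F, r = (val c)%:A.

(** All slices of a constant tensor are constants of R, hence in K, so [tensor_split] applies with J
    = 0 and l = 1. *)
Lemma lext_constant (t : E) : der t = 0 -> exists b, t = inr b.
Proof.
move=> t0.
have s0 : subspace (fun b : triv B => b = 0).
  by split=> // c v w -> ->; rewrite scaler0 addr0.
have [psi _|b Hb] := @tensor_split _ (res R) (triv B) _ (1 : res R) t s0.
  have [|c cE] := constR (r := slice psi t); last by exists c; rewrite cE.
  by rewrite -[LHS](slice_der psi t) t0 raddf0.
exists b; apply/eqP; rewrite -subr_eq0; apply/eqP.
by apply: (@lspan_null (fun b => b = 0)) => //; apply/lspanE.
Qed.
End LextSpan.

Section LextSubmodule.
Variables (F : diffFieldType) (R : diffAlgType F) (B : comAlgType (const F)).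
Local Notation E := (lext R B).
Local Notation inl := (lext_inl R B).
Local Notation inr := (lext_inr R B).
Variables (M : R -> Prop) (N : E -> Prop).

(** Used for M = {1} when R is simple with constants K, and for the nonzero elements of a domain
    whose fraction field has constants K. *)
Lemma lext_submodule_lspan :
  (forall l x, M l -> l * x = 0 -> x = 0) ->
  (forall a l : R, M l -> der a * l = a * der l ->
    exists c : const F, a = val c *: l) ->
  (forall I : R -> Prop,
    (forall a b x y, I x -> I y -> I (a * x + b * y)) ->
    (forall x, I x -> I (der x)) -> (exists2 x, I x & x != 0) ->
    exists2 l, I l & M l) ->
  (forall a b t t', N t -> N t' -> N (inl a * t + inl b * t')) ->
  (forall t, N t -> N (der t)) ->
  (forall l t, M l -> N (inl l * t) -> N t) -> N 0 ->
  forall t, N t -> lspan (fun b => N (inr b)) t.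
Proof.
move=> Mr Mc Mi Nc Nd Ns N0 t Nt; apply/lspanE.
exact: (@diff_submodule_const_span F R B M N).
Qed.
End LextSubmodule.

(** * Differential automorphisms *)

Lemma rmorphism_eq (A B : pzRingType) (f g : {rmorphism A -> B}) :
  f =1 g -> f = g.
Proof.
move=> /funext; case: f g => [f [[f1] [f2]]] [g [[g1] [g2]]] /= E.
subst g; congr (GRing.RMorphism.Pack (GRing.RMorphism.Class _ _)).
- by congr (GRing.isNmodMorphism.Axioms_ _); apply: Prop_irrelevance.
- by congr (GRing.isMonoidMorphism.Axioms_ _); apply: Prop_irrelevance.
Qed.

Section DiffAutomorphisms.
Variables (F : diffFieldType) (R : diffAlgType F) (B : comAlgType (const F)).
Local Notation E := (lext R B).

Lemma diffAut_eq (s s' : diffAut R B) : s =1 s' -> s = s'.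
Proof.
case: s s' => [f f1 f2 f3] [g g1 g2 g3] /= /rmorphism_eq E; subst g.
by congr DiffAut; apply: Prop_irrelevance.
Qed.

Lemma aut_inr (s : diffAut R B) (b : B) :
  s (lext_inr R B b : E) = (lext_inr R B b : E).
Proof.
have H : base_map R B (tinr (b : triv B)) = lext_inr R B b.
  by rewrite [LHS]tmapE [X in tens X _]rmorph1.
by have := aut_linear s (tinr (b : triv B)) 1; rewrite H rmorph1 !mulr1.
Qed.

Section AutPoint.
Variable s : diffAut R B.

(** An automorphism fixes B, so its restriction to R determines it; this restriction is a point of
    Spec R in R (x)_K B. *)
Definition aut_point_fun : R -> E := fun r => s (lext_inl R B r).
Fact aut_point_zmod : zmod_morphism aut_point_fun.
Proof. by move=> x y; rewrite /aut_point_fun !raddfB. Qed.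
HB.instance Definition _ :=
  GRing.isZmodMorphism.Build R E aut_point_fun aut_point_zmod.
Fact aut_point_monoid : monoid_morphism aut_point_fun.
Proof.
split=> [|x y]; rewrite /aut_point_fun; first by rewrite !rmorph1.
by rewrite !rmorphM.
Qed.
HB.instance Definition _ :=
  GRing.isMonoidMorphism.Build R E aut_point_fun aut_point_monoid.
Fact aut_point_scalable : scalable aut_point_fun.
Proof.
move=> c x; rewrite /aut_point_fun [lext_inl R B (c *: x)]linearZ /= !lextZE.
rewrite (_ : tinl (c%:A : res R) = base_map R B (tinl (c : res F^o))).
  exact: aut_linear.
by rewrite [RHS]tmapE rmorph1.
Qed.
HB.instance Definition _ := GRing.isScalable.Build F R E
  *:%R aut_point_fun aut_point_scalable.
Definition aut_point : {lrmorphism R -> E} := aut_point_fun.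

Lemma aut_pointE (t : E) : s t = lcopair aut_point (lext_inr R B) t.
Proof.
apply: (@lext_eq _ _ _ _ (aut s)) => [r|b].
  by rewrite [RHS]lcopair_inl.
by rewrite [RHS]lcopair_inr; apply: aut_inr.
Qed.

Lemma aut_point_der r : aut_point (der r) = der (aut_point r).
Proof. by rewrite /= /aut_point_fun -der_lext_inl; apply: aut_der. Qed.
End AutPoint.

Lemma aut_point_inj (s s' : diffAut R B) :
  aut_point s =1 aut_point s' -> s = s'.
Proof.
move=> ss'; apply: diffAut_eq => t; rewrite !aut_pointE.
by rewrite (lrmorphism_eq ss').
Qed.

(** Extended by the identity on B, [f] and [g] become mutually inverse. *)
Lemma diffAut_ex (f g : {lrmorphism R -> E}) :
  (forall r, f (der r) = der (f r)) ->
  (forall r, lcopair f (lext_inr R B) (g r) = lext_inl R B r) ->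
  (forall r, lcopair g (lext_inr R B) (f r) = lext_inl R B r) ->
  exists s : diffAut R B, aut_point s =1 f.
Proof.
move=> fder fg gf.
set u : {lrmorphism E -> E} := lcopair f (lext_inr R B).
set v : {lrmorphism E -> E} := lcopair g (lext_inr R B).
have ubij : bijective u.
  exists v => t.
    apply: (@lext_eq _ _ _ _ (v \o u) idfun) => [r|b] /=.
      by rewrite /u lcopair_inl gf.
    by rewrite /u lcopair_inr [v _]lcopair_inr.
  apply: (@lext_eq _ _ _ _ (u \o v) idfun) => [r|b] /=.
    by rewrite /v lcopair_inl fg.
  by rewrite /v lcopair_inr [u _]lcopair_inr.
have uder : forall t : E, u (der t) = der (u t).
  apply: lext_der => [r|b] /=; first by rewrite der_lext_inl /u !lcopair_inl.
  by rewrite /u lcopair_inr der_lext_inr.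
have ulin (w : cext F^o B) (t : cext R B) :
    u (base_map R B w * t) = base_map R B w * u t :> cext R B.
  rewrite [LHS](rmorphM u); congr (_ * _).
  elim/tensor_ind: w => [|x y IHx IHy|a b]; first by rewrite !raddf0.
    by rewrite [base_map _ _ _]raddfD [LHS]raddfD /= IHx IHy.
  rewrite tmapE tensE [LHS](rmorphM u) [X in _ * X](@lcopair_inr _ _ _ _ f).
  by rewrite [X in X * _](@lcopair_inl _ _ _ _ f) [f _]rmorph_alg lextZE mulr1.
exists (@DiffAut _ _ _ (u : {rmorphism cext R B -> cext R B}) ubij uder ulin).
by move=> r; rewrite /= /aut_point_fun /= [LHS](@lcopair_inl _ _ _ _ f).
Qed.

End DiffAutomorphisms.

(** * Picard-Vessiot rings are torsors *)

Lemma der_mulmx (R : diffRingType) m n p (A : 'M[R]_(m, n)) (B : 'M[R]_(n, p)) :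
  map_mx der (A *m B) = map_mx der A *m B + A *m map_mx der B.
Proof.
apply/matrixP => i j; rewrite !mxE -big_split /=.
elim/big_ind2: _ => [|x x' y y' <- <-|k _]; first exact: der0.
  by rewrite derD.
by rewrite !mxE derM.
Qed.

(** Differentiate W Z = 1 and multiply by W on the right. *)
Lemma solution_inverse_der (R : diffRingType) n (Z W A : 'M[R]_n) :
  W *m Z = 1%:M -> Z *m W = 1%:M -> map_mx der Z = A *m Z ->
  map_mx der W = - (W *m A).
Proof.
move=> WZ ZW dZ; have := der_mulmx W Z; rewrite WZ.
have -> : map_mx der (1%:M : 'M[R]_n) = 0.
  by apply/matrixP => i j; rewrite !mxE; case: eqP; rewrite ?der0 ?der1.
move/(congr1 (mulmx^~ W)); rewrite mul0mx mulmxDl -!mulmxA ZW mulmx1 dZ.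
by rewrite -mulmxA ZW mulmx1 => /esym/eqP; rewrite addr_eq0 => /eqP.
Qed.

(** The contrapositive of [diff_simple], for ideals given by propositions instead of boolean
    predicates. *)
Lemma diff_simple_ideal (R : diffRingType) (I : R -> Prop) : diff_simple R ->
  (forall a b x y, I x -> I y -> I (a * x + b * y)) ->
  (forall x, I x -> I (der x)) -> (exists2 x, I x & x != 0) -> I 1.
Proof.
move=> simR Ic Id [x Ix x0]; apply: contrapT => nI1; case/eqP: x0.
have I0 : I 0 by have := Ic 0 0 _ _ Ix Ix; rewrite !mul0r addr0.
apply: (simR (fun y => `[< I y >])); last exact/asboolP.
  split; [exact/asboolP|exact/asboolPn|move=> a u v].
  rewrite !unfold_in => /asboolP Iu /asboolP Iv; apply/asboolP.
  by have := Ic a 1 _ _ Iu Iv; rewrite mul1r.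
by move=> u; rewrite !unfold_in => /asboolP Iu; apply/asboolP/Id.
Qed.

(** * The constants of R (x)_F R *)

Section SelfTensor.
Variables (F : diffFieldType) (R : diffAlgType F).
Local Notation S := (tensor R R).
Local Notation rS := (@res F S).
Local Notation E := (lext R rS).
Local Notation inl := (lext_inl R rS).
Local Notation inr := (lext_inr R rS).

Definition is_constant (s : rS) : Prop := der (s : S) = 0.

Lemma is_constantM s s' : is_constant s -> is_constant s' -> is_constant (s * s').
Proof.
by move=> s0 s0'; apply: etrans (derM _ _) _; rewrite s0 s0' mul0r mulr0 addr0.
Qed.

Lemma is_constant1 : is_constant 1.
Proof. exact: der1. Qed.

(** The second factor is all of R (x)_F R, taken as a constant algebra. On [lspan is_constant], that
    is on R (x)_K C with C the true constants, the map is differential, injective and reaches every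
    [tinr r]. *)
Definition lext_mul : {lrmorphism E -> S} := lcopair tinl idfun.

Lemma lext_mul_inl r : lext_mul (inl r) = tinl r.
Proof. exact: lcopair_inl. Qed.

Lemma lext_mul_inr s : lext_mul (inr s : E) = s.
Proof. exact: lcopair_inr. Qed.

Lemma lext_mul_der (t : E) : lspan is_constant t ->
  lext_mul (der t) = der (lext_mul t).
Proof.
elim=> [|x y _ IHx _ IHy|r s s0]; first by rewrite !(der0, raddf0).
  by rewrite derD !raddfD derD /= IHx IHy.
rewrite der_lext_mul !rmorphM /= !lext_mul_inl lext_mul_inr derM der_tinl.
by rewrite [der s]s0 mulr0 addr0.
Qed.

Hypothesis PV : is_PV_ring R.

(* Constants of [S] that are independent over K remain so over [R]. *)
Lemma lext_mul_inj (t : E) : lspan is_constant t -> lext_mul t = 0 -> t = 0.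
Proof.
move=> Ct t0; pose N (t : E) := lspan is_constant t /\ lext_mul t = 0.
(* The kernel is spanned by those [inr b] which it contains, and [lext_mul] sends [inr b] to [b]. *)
apply: (@lspan_null _ _ _ (fun b => N (inr b))) => [b [_]|].
  by rewrite lext_mul_inr.
apply: (@lext_submodule_lspan _ _ _ (eq 1)) => //.
- by move=> _ x <-; rewrite mul1r.
- move=> a _ <-; rewrite der1 mulr0 mulr1 => a0.
  by have [c ->] := (PV_const PV a).1 a0; exists c.
- move=> I Ic Id Ix; exists 1 => //.
  exact: (diff_simple_ideal (PV_simple PV)).
- move=> a b u v [Cu u0] [Cv v0]; split.
    by apply: lspanD; apply: lspan_inlM.
  by rewrite raddfD /= !rmorphM /= u0 v0 !mulr0 addr0.
- move=> u [Cu u0]; split; first exact: lspan_der.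
  by rewrite lext_mul_der // u0 der0.
- by move=> _ u <- ; rewrite rmorph1 mul1r.
- by split; [apply: lspan0|rewrite raddf0].
Qed.

(** The image [D] of the span is a ring containing R (x) 1 and all constants, so only the generators
    1 (x) Z and 1 (x) W must be reached; both are products of a matrix over R (x) 1 and a constant
    matrix. *)
Lemma lext_mul_onto (r : R) :
  exists t : E, lspan is_constant t /\ lext_mul t = tinr r.
Proof.
pose D (s : S) := exists t : E, lspan is_constant t /\ lext_mul t = s.
have DD s s' : D s -> D s' -> D (s + s').
  move=> [t [Ct <-]] [t' [Ct' <-]]; exists (t + t'); split; first exact: lspanD.
  exact: (raddfD lext_mul).
have DM s s' : D s -> D s' -> D (s * s').
  move=> [t [Ct <-]] [t' [Ct' <-]]; exists (t * t'); split.
    by apply: lspanM => //; apply: is_constantM.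
  exact: (rmorphM lext_mul).
have Dl a : D (tinl a).
  exists (inl a); split; last exact: lext_mul_inl.
  exact/lspan_inl/is_constant1.
have Dc s : der s = 0 -> D s.
  move=> s0; exists (inr s); split; first exact: lspan_inr.
  exact: lext_mul_inr.
have D0 : D 0 by apply/Dc/der0.
have Dsum I (s : seq I) (P : pred I) (f : I -> S) : (forall i, P i -> D (f i)) ->
    D (\sum_(i <- s | P i) f i) by move=> Df; apply: (big_ind D).
have Dmx n (M N : 'M[S]_n) : (forall i j, D (M i j)) -> (forall i j, D (N i j)) ->
    forall i j, D ((M *m N) i j).
  by move=> DMx DN i j; rewrite mxE; apply: Dsum => k _; apply: DM.
have [n [Z [W [ZW WZ [A AE]] gen]]] := PV_generated PV.
pose A' := map_mx (in_alg R) A.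
have dZ : map_mx der Z = A' *m Z by rewrite /A' -AE -mulmxA WZ mulmx1.
have dW := solution_inverse_der WZ ZW dZ.
pose l := map_mx (tinl : R -> S); pose q := map_mx (tinr : R -> S).
have lM m p o (M : 'M_(m, p)) (N : 'M_(p, o)) :
    l _ _ (M *m N) = l _ _ M *m l _ _ N.
  exact: map_mxM.
have qM m p o (M : 'M_(m, p)) (N : 'M_(p, o)) :
    q _ _ (M *m N) = q _ _ M *m q _ _ N.
  exact: map_mxM.
(* The entries of A' come from F, over which the tensor product is taken. *)
have lqA : l _ _ A' = q _ _ A'.
  by apply/matrixP => i j; rewrite !mxE /= /tinl /tinr tensZ.
have dl m p (M : 'M_(m, p)) : map_mx der (l _ _ M) = l _ _ (map_mx der M).
  by apply/matrixP => i j; rewrite !mxE der_tinl.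
have dq m p (M : 'M_(m, p)) : map_mx der (q _ _ M) = q _ _ (map_mx der M).
  by apply/matrixP => i j; rewrite !mxE der_tinr.
(* With Z' = A Z and W' = - W A, the two terms of the derivative of (W (x) 1)(1 (x) Z) cancel. *)
have D1 : forall i j, D ((l _ _ W *m q _ _ Z) i j).
  move=> i j; apply: Dc; have := der_mulmx (l _ _ W) (q _ _ Z).
  rewrite dl dq dW dZ [l _ _ (- _)]map_mxN mulNmx -/(l _ _ _) lM qM lqA.
  by rewrite mulmxA addNr => /matrixP /(_ i j); rewrite !mxE.
have D2 : forall i j, D ((q _ _ W *m l _ _ Z) i j).
  move=> i j; apply: Dc; have := der_mulmx (q _ _ W) (l _ _ Z).
  rewrite dl dq dW dZ [q _ _ (- _)]map_mxN mulNmx -/(q _ _ _) lM qM lqA.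
  by rewrite mulmxA addNr => /matrixP /(_ i j); rewrite !mxE.
have DZ i j : D (tinr (Z i j)).
  have -> : tinr (Z i j) = (l _ _ Z *m (l _ _ W *m q _ _ Z)) i j.
    by rewrite mulmxA -lM ZW [l _ _ _]map_mx1 mul1mx mxE.
  by apply: Dmx => // i' j'; rewrite mxE.
have DW i j : D (tinr (W i j)).
  have -> : tinr (W i j) = ((q _ _ W *m l _ _ Z) *m l _ _ W) i j.
    by rewrite -mulmxA -lM ZW [l _ _ _]map_mx1 mulmx1 mxE.
  by apply: Dmx => // i' j'; rewrite mxE.
pose P : {pred R} := [pred r | `[< D (tinr r) >]].
have memP x : reflect (D (tinr x)) (x \in P) by apply: asboolP.
apply/memP; apply: gen => [|x].
  split=> [|a x y|x y].
  - exact/memP/Dc/der1.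
  - move=> /memP Dx /memP Dy; apply/memP.
    rewrite linearP; apply: DD => //; rewrite -[_ *: _]mulr_algl; apply: DM => //.
    by rewrite (_ : a%:A = tinl a%:A) // /tinl tensZl.
  - by move=> /memP Dx /memP Dy; apply/memP; rewrite rmorphM; apply: DM.
move=> [[i [j ->]]| ->]; apply/memP => //.
rewrite /determinant rmorph_sum; apply: Dsum => s _; rewrite rmorphM.
apply: (DM); last first.
  rewrite rmorph_prod; apply: (big_ind D) => [||i _]; last exact: DW.
    exact/Dc/der1.
  exact: DM.
rewrite rmorphXn rmorphN1; elim: (nat_of_bool _) => [|k IHk].
  exact/Dc/der1.
by rewrite exprS; apply: DM => //; rewrite -(rmorphN1 tinl); apply: Dl.
Qed.

(** The embedding r -> 1 (x) r followed by the inverse of R (x)_K C -> R (x)_F R. The preimage is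
    merely chosen; its uniqueness makes the choice an algebra map. *)
Definition const_section_fun (r : R) : E := sval (cid (lext_mul_onto r)).

Lemma const_sectionP r : lspan is_constant (const_section_fun r).
Proof. by rewrite /const_section_fun; case: cid => t []. Qed.

Lemma const_sectionE r : lext_mul (const_section_fun r) = tinr r.
Proof. by rewrite /const_section_fun; case: cid => t []. Qed.

Lemma const_section_unique r (t : E) : lspan is_constant t -> lext_mul t = tinr r ->
  const_section_fun r = t.
Proof.
move=> Ct tE; apply/eqP; rewrite -subr_eq0; apply/eqP; apply: lext_mul_inj.
  exact: lspanB (const_sectionP r) Ct.
by rewrite raddfB /= const_sectionE tE subrr.
Qed.

Fact const_section_zmod : zmod_morphism const_section_fun.
Proof.
move=> x y; apply: const_section_unique.
  by apply: lspanB; apply: const_sectionP.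
by rewrite raddfB /= !const_sectionE raddfB.
Qed.
HB.instance Definition _ :=
  GRing.isZmodMorphism.Build R E const_section_fun const_section_zmod.

Fact const_section_monoid : monoid_morphism const_section_fun.
Proof.
split=> [|x y]; apply: const_section_unique.
- by rewrite -(rmorph1 inl); apply/lspan_inl/is_constant1.
- by rewrite !rmorph1.
- by apply: lspanM; [apply: is_constantM|apply: const_sectionP..].
- by rewrite rmorphM /= !const_sectionE rmorphM.
Qed.
HB.instance Definition _ :=
  GRing.isMonoidMorphism.Build R E const_section_fun const_section_monoid.

Fact const_section_scalable : scalable const_section_fun.
Proof.
move=> c x; apply: const_section_unique.
  rewrite -[X in lspan _ X]mulr_algl -(rmorph_alg inl).
  exact/lspan_inlM/const_sectionP.
by rewrite linearZ /= const_sectionE linearZ.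
Qed.
HB.instance Definition _ := GRing.isScalable.Build F R E
  *:%R const_section_fun const_section_scalable.
Definition const_section : {lrmorphism R -> E} := const_section_fun.

Lemma const_section_der r : const_section (der r) = der (const_section r).
Proof.
apply: const_section_unique; first exact/lspan_der/const_sectionP.
by rewrite lext_mul_der ?const_sectionE ?der_tinr //; apply: const_sectionP.
Qed.

(** * The differential map carrying one point of Spec R to another *)

Section Transporter.
Variables (A : comAlgType F).

Definition eval_at (x : {lrmorphism R -> A}) :
    {lrmorphism lext R (@res F A) -> A} :=
  lcopair x (idfun : {lrmorphism @res F A -> @res F A}).

Definition copoint (x y : {lrmorphism R -> A}) :
    {lrmorphism E -> lext R (@res F A)} :=
  lcopair (lext_inl R (@res F A))
    (lext_inr R (@res F A) \o res_map (tcopair x y : {lrmorphism S -> A})).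

(** If 1 (x) r = \sum a_i c_i with constants c_i, then r goes to \sum a_i (x) (x, y)(c_i). This is
    the automorphism by which the group element taking [x] to [y] acts. *)
Definition transporter (x y : {lrmorphism R -> A}) :
    {lrmorphism R -> lext R (@res F A)} :=
  copoint x y \o const_section.

Variables (x y : {lrmorphism R -> A}).

Lemma copoint_inl r : copoint x y (inl r) = lext_inl R (@res F A) r.
Proof. exact: lcopair_inl. Qed.

Lemma copoint_inr s :
  copoint x y (inr s : E) = lext_inr R (@res F A) (tcopair x y s).
Proof. exact: lcopair_inr. Qed.

Lemma eval_at_inl r : eval_at x (lext_inl R (@res F A) r) = x r.
Proof. exact: lcopair_inl. Qed.

Lemma eval_at_inr a :
  eval_at x (lext_inr R (@res F A) a : lext R (@res F A)) = a.
Proof. exact: lcopair_inr. Qed.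

Lemma transporter_der r : transporter x y (der r) = der (transporter x y r).
Proof.
apply: etrans (congr1 (copoint x y) (const_section_der r)) _.
apply: (@lext_der _ _ _ _ (copoint x y)) => [r'|b] /=.
  by rewrite der_lext_inl !copoint_inl der_lext_inl.
by rewrite copoint_inr; apply: der_lext_inr.
Qed.

Lemma eval_copoint t : eval_at x (copoint x y t) = tcopair x y (lext_mul t).
Proof.
apply: (@lext_eq _ _ _ _ (eval_at x \o copoint x y)
  ((tcopair x y : {lrmorphism S -> A}) \o lext_mul)) => [r|b] /=.
  by rewrite copoint_inl eval_at_inl lext_mul_inl tcopairE rmorph1 mulr1.
by rewrite copoint_inr eval_at_inr lext_mul_inr.
Qed.

Lemma eval_transporter r : eval_at x (transporter x y r) = y r.
Proof.
by rewrite /= eval_copoint const_sectionE tcopairE rmorph1 mul1r.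
Qed.

End Transporter.

(* A constant [c] of [R (x)_F R] has constant image under [(inl, alpha)], so
   that image lies in [1 (x) A] and is detected by evaluation at [x]. *)
Lemma transporter_unique (A : comAlgType F) (x y : {lrmorphism R -> A})
    (alpha : {lrmorphism R -> lext R (@res F A)}) :
  (forall r, alpha (der r) = der (alpha r)) ->
  (forall r, eval_at x (alpha r) = y r) -> alpha =1 transporter x y.
Proof.
move=> ader ay r.
pose kappa : {lrmorphism S -> lext R (@res F A)} :=
  tcopair (lext_inl R (@res F A)) alpha.
have kder s : kappa (der s) = der (kappa s).
  elim/tensor_ind: s => [|s t IHs IHt|a b]; first by rewrite !(der0, raddf0).
    by rewrite derD !raddfD derD /= IHs IHt.
  rewrite der_tens !raddfD /= !tcopairE derM.
  by rewrite ader der_lext_inl.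
have evk s : eval_at x (kappa s) = tcopair x y s.
  elim/tensor_ind: s => [|s t IHs IHt|a b]; first by rewrite !raddf0.
    by rewrite !raddfD /= IHs IHt.
  by rewrite /kappa /= !tcopairE rmorphM /= ay eval_at_inl.
have kconst s : is_constant s -> kappa s = lext_inr R (@res F A) (tcopair x y s).
  move=> s0.
  have [|b kb] := lext_constant (fun r => (PV_const PV r).1) (t := kappa s).
    by rewrite -kder [der s]s0 raddf0.
  by rewrite -evk kb eval_at_inr.
(* Expanding 1 (x) r over R in constants reduces the claim to [inl], where both maps agree, and to
   constants, where [kconst] applies. *)
have -> : alpha r = kappa (tinr r) by rewrite /kappa /= tcopairE rmorph1 mul1r.
rewrite -const_sectionE /=; elim: (const_sectionP r) => [|s t _ IHs _ IHt|a b b0].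
- by rewrite !raddf0.
- by rewrite !raddfD /= IHs IHt.
rewrite !rmorphM /= lext_mul_inl lext_mul_inr (kconst b) //.
by rewrite copoint_inl copoint_inr /kappa /= tcopairE rmorph1 mulr1.
Qed.

End SelfTensor.

(** * The torsor axioms for the Galois action *)

Section PicardVessiotTorsor.
Variables (F : diffFieldType) (G : linAlgGroup (const F)) (R : diffAlgType F).
Variables (theta : galois_group G R).

Lemma gal_actE (A : comAlgType F) (x : {lrmorphism R -> A})
    (g : {lrmorphism coord_ring G -> @res F A}) r :
  gal_act theta A x g r = eval_at x (aut_point (gal theta g) r).
Proof. by []. Qed.

Lemma gal_mul_point (B : comAlgType (const F))
    (g h : {lrmorphism coord_ring G -> B}) r :
  aut_point (gal theta (gmul G g h)) r =
  lcopair (aut_point (gal theta g)) (lext_inr R B) (aut_point (gal theta h) r).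
Proof.
by rewrite -aut_pointE -[LHS]/(gal theta _ (lext_inl R B r)) galM.
Qed.

(** The automorphism attached to the unit is idempotent and injective, hence the identity. *)
Lemma gal_gone (B : comAlgType (const F)) r :
  aut_point (gal theta (gone G B)) r = lext_inl R B r.
Proof.
apply: (bij_inj (aut_bij (gal theta (gone G B)))).
rewrite -[aut_point _ r]/(gal theta (gone G B) (lext_inl R B r)).
by have := galM theta (gone G B) (gone G B) (lext_inl R B r); rewrite gmul1.
Qed.

Lemma gal_natural_point (B B' : comAlgType (const F)) (f : {lrmorphism B -> B'})
    (g : {lrmorphism coord_ring G -> B}) r :
  aut_point (gal theta (f \o g)) r =
  lcopair (lext_inl R B') (lext_inr R B' \o f) (aut_point (gal theta g) r).
Proof.
have H t : tmap idfun (triv_map f) t =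
    lcopair (lext_inl R B') (lext_inr R B' \o f) t by [].
have := gal_natural theta f g (lext_inl R B r).
by rewrite H [X in _ = X]H lcopair_inl.
Qed.

Lemma gal_act_right : is_right_action (gal_act theta).
Proof.
split.
- by move=> A x; apply: lrmorphism_eq => r; rewrite gal_actE gal_gone eval_at_inl.
- move=> A x g h; apply: lrmorphism_eq => r; rewrite !gal_actE gal_mul_point.
  move: (aut_point _ r).
  apply: (@lext_eq _ _ _ _ (eval_at (gal_act theta A x g))
    (eval_at x \o lcopair (aut_point (gal theta g)) (lext_inr R _))) => [s|b] /=.
    by rewrite eval_at_inl lcopair_inl gal_actE.
  by rewrite eval_at_inr lcopair_inr eval_at_inr.
move=> A B f x g r; rewrite /= !gal_actE gal_natural_point.
move: (aut_point _ r).
apply: (@lext_eq _ _ _ _ (f \o eval_at x) (eval_at (f \o x) \o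
  lcopair (lext_inl R _) (lext_inr R (@res F B) \o res_map f))) => [s|b] /=.
  by rewrite eval_at_inl lcopair_inl eval_at_inl.
by rewrite eval_at_inr lcopair_inr eval_at_inr.
Qed.

Hypothesis PV : is_PV_ring R.

(** The transporter from [x] to [y] extends to an automorphism, which comes from some g by
    [gal_bij]. Any g with x.g = y induces a differential map carrying [x] to [y], which must be the
    transporter. *)
Lemma PV_torsor_unique (A : comAlgType F) (x y : {lrmorphism R -> A}) :
  exists! g : {lrmorphism coord_ring G -> @res F A}, y = gal_act theta A x g.
Proof.
pose tr := transporter PV.
(* Both sides are differential maps carrying [u] to [u], so both are the transporter from [u] to
   itself. *)
have back u v r : lcopair (tr _ u v) (lext_inr R (@res F A)) (tr A v u r) =
    lext_inl R _ r.
  pose w := lcopair (tr A u v) (lext_inr R (@res F A)).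
  have w_inl s : w (lext_inl R (@res F A) s) = tr A u v s by exact: lcopair_inl.
  have w_inr a : w (lext_inr R (@res F A) a : lext R (@res F A)) =
    lext_inr R (@res F A) a by exact: lcopair_inr.
  have w_der t : w (der t) = der (w t).
    apply: (@lext_der _ _ _ _ w) => [s|b] /=.
      by rewrite der_lext_inl !w_inl; apply: transporter_der.
    by rewrite w_inr der_lext_inr.
  have w_ev t : eval_at u (w t) = eval_at v t.
    move: t; apply: (@lext_eq _ _ _ _ (eval_at u \o w) (eval_at v)) => [s|b] /=.
      by rewrite eval_at_inl w_inl; apply: eval_transporter.
    by rewrite w_inr !eval_at_inr.
  have H1 := @transporter_unique _ _ PV A u u (w \o tr A v u)
    (fun s => etrans (congr1 w (transporter_der PV v u s)) (w_der _))
    (fun s => etrans (w_ev _) (eval_transporter PV v u s)).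
  have H2 := @transporter_unique _ _ PV A u u (lext_inl R (@res F A))
    (fun s => esym (der_lext_inl _ s)) (eval_at_inl u).
  exact: etrans (H1 r) (esym (H2 r)).
have [s sE] := diffAut_ex (transporter_der PV x y) (back x y) (back y x).
have [gal' galK gal'K] := gal_bij theta (@res F A).
exists (gal' s); split=> [|g yE].
  apply: lrmorphism_eq => r.
  by rewrite gal_actE gal'K sE eval_transporter.
apply: (can_inj galK); rewrite gal'K; apply: aut_point_inj => r.
rewrite sE; symmetry; apply: (transporter_unique PV); first exact: aut_point_der.
by move=> r'; rewrite yE gal_actE.
Qed.

Lemma PV_finite_type : finite_type R.
Proof.
have [n [Z [W [_ _ _ gen]]]] := PV_generated PV.
exists (\det W :: [seq Z p.1 p.2 | p : 'I_n * 'I_n]) => P subP sP.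
apply: gen => // r [[i [j ->]]| ->]; apply: sP; rewrite in_cons ?eqxx //.
by rewrite (_ : Z i j \in _) ?orbT //; apply/fintype.imageP; exists (i, j).
Qed.

Lemma gal_act_comp (A : comAlgType F) (x : {lrmorphism R -> A})
    (B : comAlgType (const F)) (f : {lrmorphism B -> @res F A})
    (g : {lrmorphism coord_ring G -> B}) r :
  gal_act theta A x (f \o g) r = lcopair x f (aut_point (gal theta g) r).
Proof.
rewrite gal_actE gal_natural_point; move: (aut_point _ r).
apply: (@lext_eq _ _ _ _ (eval_at x \o lcopair (lext_inl R (@res F A))
  (lext_inr R (@res F A) \o f)) (lcopair x f)) => [s|b] /=.
  by rewrite !lcopair_inl.
by rewrite !lcopair_inr.
Qed.

Lemma lcopair_der (A : diffAlgType F) (B : comAlgType (const F))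
    (f : {lrmorphism R -> A}) (g : {lrmorphism B -> @res F A}) :
  (forall r, f (der r) = der (f r)) -> (forall b, der (g b : A) = 0) ->
  forall t, lcopair f g (der t) = der (lcopair f g t).
Proof.
move=> fder gder; apply: (@lext_der _ _ _ _ (lcopair f g)) => [s|b] /=.
  by rewrite der_lext_inl !lcopair_inl fder.
by rewrite lcopair_inr gder.
Qed.

(** The co-action is the automorphism of the universal point [idfun] followed by R (x)_K K[G] -> R
    (x)_F F[G], which is differential because K[G] maps to constants. *)
Lemma PV_coaction_der r :
  coaction (gal_act theta) (der r) = der (coaction (gal_act theta) r).
Proof.
pose H := coord_ring G; pose A := tensor R (bext H).
pose g : {lrmorphism H -> @res F A} :=
  res_map (tinr : {lrmorphism bext H -> A}) \o bext_in H.
have E s : coaction (gal_act theta) s =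
    lcopair (tinl : {lrmorphism R -> A}) g (aut_point (gal theta idfun) s).
  rewrite -gal_act_comp; congr (gal_act theta _ _ _ s); exact: lrmorphism_eq.
rewrite !E aut_point_der; apply: lcopair_der => [s|h].
  exact: esym (@der_tinl F R (bext H) s).
rewrite (der_tinr R (bext_in H h)).
by rewrite -[der _]/(der (tens (1 : res F^o) (h : triv H))) der_tens_triv der1
  tens0l raddf0.
Qed.

Lemma PV_diff_torsor : is_diff_torsor (gal_act theta).
Proof.
split; last exact: PV_coaction_der.
by split; [apply: PV_finite_type|apply: gal_act_right|apply: PV_torsor_unique].
Qed.
End PicardVessiotTorsor.

(** * Torsors: the Galois group *)

Section GroupPoints.
Variables (K : fieldType) (G : linAlgGroup K).

(** From the left-sided group axioms, this yields naturality of the unit and right inverses. *)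
Lemma gmul_idem (A : comAlgType K) (g : {lrmorphism coord_ring G -> A}) :
  gmul G g g = g -> g = gone G A.
Proof. by move=> gg; rewrite -[LHS]gmul1 -(gmulV g) -gmulA gg. Qed.

Lemma gone_natural (A B : comAlgType K) (f : {lrmorphism A -> B}) :
  f \o gone G A = gone G B :> {lrmorphism coord_ring G -> B}.
Proof.
apply: gmul_idem; apply: lrmorphism_eq => h.
by rewrite -(gmul_natural f (gone G A) (gone G A)) gmul1.
Qed.

Lemma gmulgV (A : comAlgType K) (g : {lrmorphism coord_ring G -> A}) :
  gmul G g (ginv G g) = gone G A.
Proof.
by apply: gmul_idem; rewrite -gmulA (gmulA _ g) gmulV gmul1.
Qed.
End GroupPoints.

Section BaseChange.
Variables (F : diffFieldType) (R : diffAlgType F) (H : comAlgType (const F)).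

Definition bext_lext_fun : bext H -> lext R H := base_map R H.
HB.instance Definition _ := GRing.RMorphism.copy bext_lext_fun (base_map R H).
Fact bext_lext_scalable : scalable bext_lext_fun.
Proof.
move=> c t; rewrite lextZE -[c *: t]/(tinl (c : res F^o) * (t : cext F^o H)).
by rewrite [LHS](rmorphM (base_map R H)) [X in X * _ = _]tmapE rmorph1.
Qed.
HB.instance Definition _ := GRing.isScalable.Build F (bext H) (lext R H)
  *:%R bext_lext_fun bext_lext_scalable.
Definition bext_lext : {lrmorphism bext H -> lext R H} := bext_lext_fun.

Lemma bext_lext_tens (a : res F^o) (h : triv H) :
  bext_lext (tens a h) = tens ((a : F) *: (1 : R) : res R) h.
Proof. exact: tmapE. Qed.

Lemma bext_lext_in h : bext_lext (bext_in H h) = lext_inr R H h.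
Proof. by rewrite [LHS]tmapE [X in tens X _]rmorph1. Qed.

Lemma bext_lext_der t : bext_lext (der t) = der (bext_lext t).
Proof.
elim/tensor_ind: t => [|x y IHx IHy|a h].
- by rewrite [der _]der0 raddf0 der0.
- by rewrite [der _]derD raddfD /= IHx IHy -derD -raddfD.
apply: etrans (congr1 bext_lext (der_tens_triv (R := F^o) a h)) _.
rewrite !bext_lext_tens [RHS]der_tens_triv; congr tens; exact: esym (@der_alg F R a).
Qed.
End BaseChange.

(** * The torsor isomorphism and the automorphisms given by group points *)

Section TorsorPoints.
Variables (F : diffFieldType) (G : linAlgGroup (const F)) (R : diffAlgType F).
Variable act : action_on G R.
Hypothesis tors : is_diff_torsor act.
Local Notation H := (coord_ring G).
Local Notation S := (tensor R R).

Let actR := torsor_action (diff_torsor tors).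
Let actU := torsor_unique (diff_torsor tors).

Lemma act_inj (A : comAlgType F) (x : {lrmorphism R -> A})
    (g h : {lrmorphism H -> @res F A}) : act x g =1 act x h -> g = h.
Proof.
move=> /lrmorphism_eq E; have [k [kE kU]] := actU x (act x h).
by rewrite -(kU h erefl); apply/esym/kU.
Qed.

Section Points.
Variable B : comAlgType (const F).

(** The tautological point of Spec R moved by g. For B = K[G] and g = [idfun] it is the co-action,
    read in R (x)_K K[G]. *)
Definition orbit_map (g : {lrmorphism H -> B}) : {lrmorphism R -> lext R B} :=
  act (lext_inl R B) (lext_inr R B \o g).

Lemma orbit_mapE (A : comAlgType F) (x : {lrmorphism R -> A})
    (f : {lrmorphism B -> @res F A}) (g : {lrmorphism H -> B}) r :
  lcopair x f (orbit_map g r) = act x (f \o g) r.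
Proof.
have := act_natural actR (lcopair x f) (lext_inl R B) (lext_inr R B \o g) r.
move=> /= ->; congr (act _ _ r); apply: lrmorphism_eq => s /=.
  exact: lcopair_inl.
exact: (@lcopair_inr _ _ _ _ x f (g s)).
Qed.

Lemma orbit_map_mul (g h : {lrmorphism H -> B}) r :
  lcopair (orbit_map g) (lext_inr R B) (orbit_map h r) =
  orbit_map (gmul G g h) r.
Proof.
rewrite orbit_mapE /orbit_map (actM actR); congr (act _ _ r).
by apply: lrmorphism_eq => s; rewrite [RHS]gmul_natural.
Qed.

Lemma orbit_map_one r : orbit_map (gone G B) r = lext_inl R B r.
Proof. by rewrite /orbit_map gone_natural (act1 actR). Qed.
End Points.

Lemma orbit_map_comp (B B' : comAlgType (const F)) (f : {lrmorphism B -> B'})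
    (g : {lrmorphism H -> B}) r :
  lcopair (lext_inl R B') (lext_inr R B' \o f) (orbit_map g r) =
  orbit_map (f \o g) r.
Proof. by rewrite orbit_mapE; congr (act _ _ r); apply: lrmorphism_eq. Qed.

(** Naturality reduces to g = [idfun], where this is the hypothesis on the co-action transported
    along R (x)_F F[G] -> R (x)_K K[G]. *)
Lemma orbit_map_der (B : comAlgType (const F)) (g : {lrmorphism H -> B}) r :
  orbit_map g (der r) = der (orbit_map g r).
Proof.
pose A := tensor R (bext H).
have uder s : orbit_map idfun (der s) = der (orbit_map idfun s).
  pose f : {lrmorphism A -> lext R H} := tcopair (lext_inl R H) (bext_lext R H).
  have fE t : orbit_map idfun t = f (coaction act t).
    have := act_natural actR f (tinl : {lrmorphism R -> A})
      (res_map (tinr : {lrmorphism bext H -> A}) \o bext_in H) t.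
    move=> /= ->; congr (act _ _ t); apply: lrmorphism_eq => h /=.
      by rewrite /f /= tcopairE rmorph1 mulr1.
    by rewrite /f /res_fun /= tcopairE rmorph1 mul1r bext_lext_in.
  have fder t : f (der t) = der (f t).
    rewrite /f /=; elim/tensor_ind: t => [|x y IHx IHy|a b].
    - by rewrite !(der0, raddf0).
    - by rewrite derD !raddfD derD /= IHx IHy.
    rewrite der_tens raddfD /= !tcopairE derM.
    by rewrite -der_lext_inl bext_lext_der.
  by rewrite !fE (diff_coaction tors) fder.
have E t : orbit_map g t =
    lcopair (lext_inl R B) (lext_inr R B \o g) (orbit_map idfun t).
  by rewrite orbit_map_comp; congr (orbit_map _ t); apply: lrmorphism_eq.
rewrite !E uder; apply: lcopair_der => [s|h]; first by rewrite der_lext_inl.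
exact: der_lext_inr.
Qed.

(** The universal g with y = x.g, for the two universal points of Spec R in R (x)_F R. *)
Definition division_point : {lrmorphism H -> @res F S} :=
  sval (cid (actU (tinl : {lrmorphism R -> S}) tinr)).

Lemma division_pointE : act tinl division_point =1 (tinr : R -> S).
Proof. by rewrite /division_point; case: cid => g [/= <-]. Qed.

(** On coordinate rings, the map (x, g) -> (x, x.g) from X x G to X x X; [of_division] inverts
    it. *)
Definition to_division : {lrmorphism S -> lext R H} :=
  tcopair (lext_inl R H) (orbit_map idfun).

Definition of_division : {lrmorphism lext R H -> S} :=
  lcopair tinl division_point.

(** Specialized at (x, y), [division_point] becomes a group point carrying [x] to [y]; uniqueness
    identifies it with g. *)
Lemma tcopair_division (A : comAlgType F) (x y : {lrmorphism R -> A})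
    (g : {lrmorphism H -> @res F A}) : act x g =1 y ->
  forall h, tcopair x y (division_point h) = g h.
Proof.
move=> xg h; pose f : {lrmorphism S -> A} := tcopair x y.
suff -> : g = res_map f \o division_point by [].
apply: (@act_inj A x) => r; rewrite xg.
have := act_natural actR f tinl division_point r.
rewrite /= [act tinl _ r]division_pointE /f /= tcopairE rmorph1 mul1r => ->.
congr (act _ _ r); apply: lrmorphism_eq => s //=.
by rewrite tcopairE rmorph1 mulr1.
Qed.

Lemma to_divisionK : cancel to_division of_division.
Proof.
elim/tensor_ind => [|x y IHx IHy|a b]; first by rewrite !raddf0.
  by rewrite !raddfD /= IHx IHy.
rewrite /to_division /= tcopairE rmorphM /= lcopair_inl orbit_mapE.
rewrite tensE -division_pointE; congr (_ * act _ _ b); exact: lrmorphism_eq.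
Qed.

Lemma to_division_der s : to_division (der s) = der (to_division s).
Proof.
elim/tensor_ind: s => [|x y IHx IHy|a b]; first by rewrite !(der0, raddf0).
  by rewrite derD !raddfD derD /= IHx IHy.
by rewrite der_tens raddfD /= !tcopairE derM orbit_map_der der_lext_inl.
Qed.

(** Under the torsor isomorphism this element becomes 1 (x) h, which is constant. *)
Lemma division_point_const h : der (division_point h : S) = 0.
Proof.
apply: (can_inj to_divisionK); rewrite to_division_der raddf0.
have -> : to_division (division_point h) = lext_inr R H h.
  by apply: (tcopair_division (g := lext_inr R H \o idfun)).
exact: der_lext_inr.
Qed.

Lemma of_division_der t : of_division (der t) = der (of_division t).
Proof.
apply: lcopair_der => [r|h]; last exact: division_point_const.
exact: esym (der_tinl R r).
Qed.

(** Chosen preimages form an algebra map because [lext_inr] is injective. *)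
Lemma lrmorphism_lift (B : comAlgType (const F))
    (g : {lrmorphism H -> @res F (lext R B)}) :
  (forall h, exists b, g h = lext_inr R B b) ->
  exists f : {lrmorphism H -> B}, g =1 lext_inr R B \o f.
Proof.
move=> gP; pose f h := sval (cid (gP h)).
have fE h : lext_inr R B (f h) = g h by rewrite /f; case: cid.
have fL : linear f.
  move=> c u v; apply: (@lext_inr_inj F R B).
  by rewrite [RHS]linearP /= !fE linearP.
have fM : monoid_morphism f.
  split=> [|u v]; apply: (@lext_inr_inj F R B).
    by rewrite fE !rmorph1.
  by rewrite [RHS]rmorphM /= !fE rmorphM.
pose f1 := GRing.isLinear.Build _ H B *:%R f fL.
pose f2 := GRing.isMonoidMorphism.Build H B f fM.
pose f' : {lrmorphism H -> B} := HB.pack f f1 f2.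
by exists f' => h /=; rewrite fE.
Qed.

Hypothesis constR : forall r : R, der r = 0 -> exists c : const F, r = (val c)%:A.

(** The group point taking [lext_inl] to [aut_point s] is a specialization of [division_point] along
    a differential map. Its values are therefore constants of R (x)_K B, so they lie in B. *)
Lemma aut_orbit_map (B : comAlgType (const F)) (s : diffAut R B) :
  exists g : {lrmorphism H -> B}, aut_point s =1 orbit_map g.
Proof.
have [g' [sE _]] := actU (lext_inl R B) (aut_point s).
have gE := tcopair_division
  (fun r => esym (congr1 (fun f : {lrmorphism _ -> _} => f r) sE)).
have [h|g g'E] := @lrmorphism_lift B g'.
  apply: (lext_constant constR); rewrite -gE.
  pose f : {lrmorphism S -> lext R B} := tcopair (lext_inl R B) (aut_point s).
  suff fder t : f (der t) = der (f t).
    by rewrite -[LHS]fder division_point_const raddf0.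
  elim/tensor_ind: t => [|x y IHx IHy|a b]; first by rewrite !(der0, raddf0).
    by rewrite derD !raddfD derD /= IHx IHy.
  rewrite der_tens raddfD /f /= !tcopairE derM.
  by rewrite aut_point_der der_lext_inl.
exists g => r; rewrite sE; congr (act _ _ r); exact: lrmorphism_eq.
Qed.

Lemma orbit_aut_ex (B : comAlgType (const F)) (g : {lrmorphism H -> B}) :
  exists s : diffAut R B, aut_point s =1 orbit_map g.
Proof.
apply: (@diffAut_ex _ _ _ _ (orbit_map (ginv G g))) => [|r|r].
- exact: orbit_map_der.
- by rewrite orbit_map_mul gmulgV orbit_map_one.
- by rewrite orbit_map_mul gmulV orbit_map_one.
Qed.

Definition orbit_aut (B : comAlgType (const F)) (g : {lrmorphism H -> B}) :
  diffAut R B := sval (cid (orbit_aut_ex g)).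

Lemma orbit_autE (B : comAlgType (const F)) (g : {lrmorphism H -> B}) :
  aut_point (orbit_aut g) = orbit_map g.
Proof. by apply: lrmorphism_eq; rewrite /orbit_aut; case: cid. Qed.

Lemma orbit_aut_bij (B : comAlgType (const F)) : bijective (@orbit_aut B).
Proof.
pose inv (s : diffAut R B) := sval (cid (aut_orbit_map s)).
have invE s : aut_point s =1 orbit_map (inv s) by rewrite /inv; case: cid.
have K : cancel inv (@orbit_aut B).
  by move=> s; apply: aut_point_inj => r; rewrite orbit_autE invE.
exists inv => // g; apply: lrmorphism_eq => h; apply: (@lext_inr_inj F R B).
have : orbit_map (inv (orbit_aut g)) =1 orbit_map g.
  by move=> r; rewrite -invE orbit_autE.
by move=> /act_inj /(congr1 (fun f : {lrmorphism _ -> _} => f h)).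
Qed.

Lemma orbit_aut_mul (B : comAlgType (const F)) (g h : {lrmorphism H -> B}) :
  orbit_aut (gmul G g h) =1 orbit_aut g \o orbit_aut h.
Proof.
move=> t; rewrite /= !aut_pointE !orbit_autE; move: t.
apply: (@lext_eq _ _ _ _ (lcopair _ _)
  (lcopair (orbit_map g) (lext_inr R B) \o
   lcopair (orbit_map h) (lext_inr R B))) => [r|b] /=.
  by rewrite !lcopair_inl orbit_map_mul.
by rewrite !lcopair_inr.
Qed.

Lemma orbit_aut_natural (B B' : comAlgType (const F)) (f : {lrmorphism B -> B'})
    (g : {lrmorphism H -> B}) (t : cext R B) :
  orbit_aut (f \o g) (tmap idfun (triv_map f) t) =
  tmap idfun (triv_map f) (orbit_aut g t).
Proof.
pose w := lcopair (lext_inl R B') (lext_inr R B' \o f).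
have wE u : tmap idfun (triv_map f) u = w u by [].
rewrite wE [RHS]wE !aut_pointE !orbit_autE; move: t.
apply: (@lext_eq _ _ _ _ (lcopair (orbit_map (f \o g)) (lext_inr R B') \o w)
  (w \o lcopair (orbit_map g) (lext_inr R B))) => [r|b] /=.
  by rewrite /w !lcopair_inl orbit_map_comp.
by rewrite /w !lcopair_inr.
Qed.

Definition torsor_galois : galois_group G R :=
  GaloisGroup orbit_aut_bij orbit_aut_mul orbit_aut_natural.

Lemma torsor_galois_act (A : comAlgType F) (x : {lrmorphism R -> A})
    (g : {lrmorphism H -> @res F A}) : gal_act torsor_galois A x g = act x g.
Proof.
apply: lrmorphism_eq => r; rewrite gal_actE orbit_autE [LHS]orbit_mapE.
by congr (act _ _ r); apply: lrmorphism_eq.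
Qed.
End TorsorPoints.

(** * Torsors: simplicity *)

Section RelativelyConstant.
Variables (F : diffFieldType) (R : diffIdomainAlgType F).
Hypothesis const_frac : forall x : {fraction R},
  der x = 0 <-> exists c : const F, x = FracField.tofrac ((val c)%:A : R).

Lemma frac_constant (r : R) : der r = 0 <-> exists c : const F, r = (val c)%:A.
Proof.
split=> [r0|[c ->]]; last by rewrite der_alg der_const scale0r.
have [|c cE] := (const_frac (FracField.tofrac r)).1.
  by rewrite der_tofrac r0 tofrac0.
by exists c; apply/eqP; rewrite -tofrac_eq cE.
Qed.

(** The equation says that a / l has derivative zero in Frac(R). *)
Lemma frac_proportional (a l : R) : l != 0 -> der a * l = a * der l ->
  exists c : const F, a = val c *: l.
Proof.
move=> l0 E.
have [|c cE] := (const_frac (FracField.tofrac a / FracField.tofrac l)).1.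
  by rewrite /der /= frac_derE // E subrr tofrac0 mul0r.
exists c; apply/eqP; rewrite -tofrac_eq -[_ *: l]mulr_algl tofracM -cE.
by rewrite divfK // tofrac_eq0.
Qed.

Variables (G : linAlgGroup (const F)) (act : action_on G R).
Hypothesis tors : is_diff_torsor act.
Local Notation H := (coord_ring G).
Local Notation S := (tensor R R).
Local Notation E := (lext R H).
Local Notation inl := (lext_inl R H).
Local Notation inr := (lext_inr R H).
Local Notation rho := (orbit_map act idfun).
Local Notation pi := (of_division tors).

(* For a proper differential ideal [I], the preimage in [R (x)_K K[G]] of the
   saturation of [R (x)_F I] is spanned by a proper ideal [J] of [K[G]].  As
   [rho] maps [I] into the span of [J], so does its inverse automorphism, which
   brings [I] itself into the span of [J], hence to [0]. *)
Lemma torsor_simple : diff_simple R.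
Proof.
move=> I [I0 I1 IL] Ider u Iu.
have IM a v : v \in I -> a * v \in I.
  by move=> Iv; rewrite -[_ * _]addr0; apply: IL.
pose IS : S -> Prop := tspan (fun v => v \in I).
have ISM w s : IS s -> IS (w * s).
  elim=> [|x y _ Ix _ Iy|a v Iv]; first by rewrite mulr0; apply: tspan0.
    by rewrite mulrDr; apply: tspanD.
  elim/tensor_ind: w => [|x y IHx IHy|b c].
  - by rewrite mul0r; apply: tspan0.
  - by rewrite mulrDl; apply: tspanD.
  - by rewrite -tensM; apply/tspan_tens/IM.
have IS_der s : IS s -> IS (der s).
  elim=> [|x y _ Ix _ Iy|a v Iv]; first by rewrite der0; apply: tspan0.
    by rewrite derD; apply: tspanD.
  by rewrite der_tens; apply: tspanD; apply: tspan_tens => //; apply: Ider.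
pose N (t : E) := exists2 d : R, d != 0 & IS (tinl d * pi t).
have NM w t : N t -> N (w * t).
  by move=> [d d0 Id]; exists d => //; rewrite rmorphM mulrCA; apply: ISM.
have ND t t' : N t -> N t' -> N (t + t').
  move=> [d d0 Id] [e e0 Ie]; exists (d * e); first by rewrite mulf_neq0.
  rewrite raddfD rmorphM /= mulrDr; apply: tspanD.
    by rewrite mulrAC mulrC; apply: ISM.
  by rewrite -mulrA; apply: ISM.
have N0 : N 0.
  by exists 1; rewrite ?oner_neq0 // raddf0 mulr0; apply: tspan0.
have Nder t : N t -> N (der t).
  move=> [d d0 Id]; exists (d * d); first by rewrite mulf_neq0.
  rewrite of_division_der.
  (* The second factor [d] absorbs the product-rule term containing [der d]. *)
  have -> : tinl (d * d) * der (pi t) =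
      tinl d * der (tinl d * pi t) - tinl (der d) * (tinl d * pi t).
    rewrite derM der_tinl mulrDr !rmorphM /= -!mulrA addrC addrA.
    by rewrite [X in - X + _]mulrCA addNr add0r.
  by apply: tspanB; apply: ISM => //; apply: IS_der.
have Nsat (l : R) t : l != 0 -> N (inl l * t) -> N t.
  move=> l0 [d d0 Id]; exists (d * l); first by rewrite mulf_neq0.
  by move: Id; rewrite !rmorphM /= mulrA [pi (inl l)]lcopair_inl.
pose J (h : H) := N (inr h).
have NJ t : N t -> lspan J t.
  apply: (@lext_submodule_lspan F R H (fun l => l != 0)) => //.
  - by move=> l x l0 /eqP; rewrite mulf_eq0 (negPf l0) => /eqP.
  - exact: frac_proportional.
  - by move=> a b t1 t2 N1 N2; apply: ND; apply: NM.
have sJ : subspace J.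
  split=> [|c v w Jv Jw]; first by rewrite /J raddf0.
  rewrite /J raddfD; apply: ND Jw.
  by rewrite -[c *: v]mulr_algl; rewrite [X in N X]rmorphM; apply: NM.
have JM h v : J v -> J (h * v) by move=> Jv; rewrite /J rmorphM; apply: NM.
(* Otherwise d (x) 1 lies in R (x)_F I with d nonzero; its slice along an F-functional killing I
   with value 1 at 1 is d, yet must vanish. *)
have nJ1 : ~ J 1.
  move=> [d /eqP d0]; rewrite !rmorph1 mulr1 => Id; apply: d0.
  have sI : subspace (fun v : R => v \in I).
    by split=> // c v w Iv Iw; rewrite -mulr_algl; apply: IL.
  have [|phi [phiI phi1]] := separating_functional sI (a := 1); first exact/negP.
  by have := slice_tspan phiI Id; rewrite sliceE phi1 scale1r.
pose g : {lrmorphism H -> H} := ginv G idfun.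
apply: (lspan_inl_eq0 sJ nJ1).
have Jrho : lspan J (rho u).
  apply: NJ; exists 1; rewrite ?oner_neq0 // rmorph1 mul1r.
  have -> : rho u = to_division act (tinr u) by rewrite /= tcopairE rmorph1 mul1r.
  by rewrite to_divisionK; apply: tspan_tens.
have -> : inl u = lcopair (orbit_map act g) (lext_inr R H) (rho u).
  by rewrite (orbit_map_mul tors) gmulV (orbit_map_one tors).
elim: Jrho => [|x y _ Jx _ Jy|r v Jv]; first by rewrite raddf0; apply: lspan0.
  by rewrite raddfD; apply: lspanD.
rewrite rmorphM /= lcopair_inl lcopair_inr.
move: (orbit_map act g r) => t; elim/lext_ind: t => [x y Jx Jy|r' h].
  by rewrite mulrDl; apply: lspanD.
by rewrite -mulrA -[X in _ * X](rmorphM inr); apply/lspan_mul/JM.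
Qed.
End RelativelyConstant.

(** * Torsors: generation by a fundamental matrix *)

Section IndependentSequences.
Variables (k : fieldType).

Definition in_span (V : lmodType k) (g : nat -> V) n (x : V) : Prop :=
  exists c : nat -> k, x = \sum_(i < n) c i *: g i.

(** Independence is stated term by term, the form which the minimal order of a differential equation
    provides directly. *)
Definition free_upto (V : lmodType k) (g : nat -> V) n : Prop :=
  forall j, (j < n)%N -> ~ in_span g j (g j).

Lemma in_span_subspace (V : lmodType k) (g : nat -> V) n : subspace (in_span g n).
Proof.
split=> [|c v w [a ->] [b ->]].
  by exists (fun=> 0); rewrite big1 // => i _; rewrite scale0r.
exists (fun i => c * a i + b i); rewrite scaler_sumr -big_split /=.
by apply: eq_bigr => i _; rewrite scalerDl scalerA.
Qed.

Lemma mem_in_span (V : lmodType k) (g : nat -> V) n i :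
  (i < n)%N -> in_span g n (g i).
Proof.
move=> lt_in; exists (fun j => (j == i)%:R).
rewrite (bigD1 (Ordinal lt_in)) //= eqxx scale1r big1 ?addr0 // => j.
by rewrite -val_eqE /= => /negPf ->; rewrite scale0r.
Qed.

Variables (A B : comAlgType k).

(** A functional killing the earlier [g i] with value 1 at the last one isolates the last
    coefficient; then induct. *)
Lemma tens_free (g : nat -> B) (a : nat -> A) n : free_upto g n ->
  \sum_(i < n) tens (a i) (g i) = 0 -> forall i, (i < n)%N -> a i = 0.
Proof.
elim: n => [//|n IHn] fr; rewrite big_ord_recr /= => sum0.
have an : a n = 0.
  have [phi [phi0 phi1]] :=
    separating_functional (in_span_subspace g n) (fr n (ltnSn n)).
  move/(congr1 (slice phi)): sum0; rewrite raddfD /= sliceE phi1 scale1r.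
  rewrite raddf_sum /= big1 ?raddf0 ?add0r // => i _.
  by rewrite sliceE phi0 ?scale0r //; apply: mem_in_span.
move: sum0; rewrite an tens0l addr0 => sum0 i.
rewrite ltnS leq_eqVlt => /orP[/eqP -> //|]; apply: IHn sum0 _.
by move=> j ltjn; apply: fr; apply: leq_trans ltjn _.
Qed.

(** A further term x (x) b is absorbed into the coefficients when [b] depends on the family, and
    extends the family otherwise. *)
Lemma tens_normal (t : tensor A B) : exists n (a : nat -> A) (h : nat -> B),
  free_upto h n /\ t = \sum_(i < n) tens (a i) (h i).
Proof.
rewrite -[t]tclassK; elim: (repr t) => [|[x b] s [n [a [h [fr IH]]]]].
  by exists 0%N, (fun=> 0), (fun=> 0); rewrite big_ord0.
rewrite -cat1s tclass_cat IH -/(tens x b).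
have [[c ->]|nb] := pselect (in_span h n b).
  exists n, (fun i => a i + c i *: x), h; split=> //.
  have -> : tens x (\sum_(i < n) c i *: h i) = \sum_(i < n) tens (c i *: x) (h i).
    elim/big_rec2: _ => [|i u v _ <-]; first by rewrite tens0r.
    by rewrite tensDr tensZ.
  by rewrite addrC -big_split /=; apply: eq_bigr => i _; rewrite tensDl.
exists n.+1, (fun i => if i == n then x else a i),
  (fun i => if i == n then b else h i).
have lt_neq i j : (i < j)%N -> (i == j) = false by move=> /ltn_eqF.
split=> [j|]; last first.
  rewrite big_ord_recr /= eqxx addrC; congr (_ + _).
  by apply: eq_bigr => i _; rewrite lt_neq.
rewrite ltnS leq_eqVlt => /orP[/eqP ->|ltjn].
  rewrite eqxx => -[c bE]; apply: nb; exists c; rewrite bE.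
  by apply: eq_bigr => i _; rewrite lt_neq.
rewrite lt_neq // => -[c hE]; apply: (fr j ltjn); exists c; rewrite hE.
by apply: eq_bigr => i _; rewrite lt_neq // (ltn_trans _ ltjn).
Qed.
End IndependentSequences.

Section FractionMatrices.
Variable R : diffIdomainType.
Local Notation tofrac := (@FracField.tofrac R).

Lemma common_denominator m (v : 'rV[{fraction R}]_m) :
  exists (d : R) (a : 'rV[R]_m), d != 0 /\ map_mx tofrac a = tofrac d *: v.
Proof.
pose den i := \d_(repr (v 0 i)); pose num i := \n_(repr (v 0 i)).
have den0 i : den i != 0 by apply: denom_ratioP.
exists (\prod_i den i), (\row_i (num i * \prod_(j | j != i) den j)).
split; first by apply/prodf_neq0 => i _.
apply/matrixP => i j; rewrite ord1 !mxE [in RHS](bigD1 j) //= !tofracM.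
rewrite [v 0 j]fracE -/(num j) -/(den j) [RHS]mulrACA [X in _ = X * _]mulrC.
by rewrite -[RHS]mulrA [X in _ = _ * X]mulrCA divff ?mulr1 // tofrac_eq0.
Qed.

(** Clearing denominators, the rows are independent over Frac(R) too; the rank is thus m, which
    yields a nonzero minor of size m. *)
Lemma independent_columns m n (M : 'M[R]_(m, n)) :
  (forall a : 'rV_m, a *m M = 0 -> a = 0) ->
  (m <= n)%N /\ exists phi : 'I_m -> 'I_n, \det (colsub phi M) != 0.
Proof.
move=> Mfree; pose M' := map_mx tofrac M.
have : row_free M'.
  rewrite -kermx_eq0; apply/rowV0P => v /sub_kermxP vM.
  have [d [a [d0 aE]]] := common_denominator v.
  have /Mfree a0 : a *m M = 0.
    apply/matrixP => i j; apply/eqP; rewrite -tofrac_eq.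
    have := congr1 (fun N : 'M_(_, _) => N i j) (map_mxM tofrac a M).
    by rewrite aE -scalemxAl vM scaler0 !mxE => ->; rewrite tofrac0.
  apply/eqP; have /eqP : tofrac d *: v = 0 by rewrite -aE a0 map_mx0.
  by rewrite scaler_eq0 tofrac_eq0 (negPf d0).
move=> Mf; have rk : \rank M' = m by apply/eqP.
split; first by rewrite -rk rank_leq_col.
have full : row_full M'^T by rewrite /row_full mxrank_tr rk.
exists (fullrankfun full); rewrite -tofrac_eq0 -det_map_mx.
have := fullrowsub_unit full; rewrite unitmxE unitfE -det_tr; congr (\det _ != 0).
by apply/matrixP => i j; rewrite !mxE.
Qed.
End FractionMatrices.

Section Companion.
Variables (F : diffFieldType) (R : diffAlgType F) (m : nat) (b : nat -> F).

Definition companion : 'M[F]_m :=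
  \matrix_(j, k) if j.+1 == m then b k else ((k : nat) == j.+1)%:R.

Lemma companionE (f : R) : iter m der f = \sum_(k < m) b k *: iter k der f ->
  forall j : 'I_m, iter j.+1 der f =
    \sum_(k < m) in_alg R (companion j k) * iter k der f.
Proof.
move=> fE j; have [jm|jm] := eqVneq j.+1 m.
  rewrite jm fE; apply: eq_bigr => k _.
  by rewrite mulr_algl mxE jm eqxx.
have ltj : (j.+1 < m)%N by rewrite ltn_neqAle jm ltn_ord.
rewrite (bigD1 (Ordinal ltj)) //= mulr_algl mxE (negPf jm) eqxx scale1r.
rewrite big1 ?addr0 // => k; rewrite -val_eqE /= => kj.
by rewrite mulr_algl mxE (negPf jm) (negPf kj) scale0r.
Qed.
End Companion.

(* The [r] for which [r Z^-1] has entries in [R] form a differential ideal. *)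
Lemma solution_invertible (R : diffIdomainType) n (Z A : 'M[R]_n) :
  diff_simple R -> map_mx der Z = A *m Z -> \det Z != 0 ->
  exists W, W *m Z = 1%:M /\ Z *m W = 1%:M.
Proof.
move=> simR dZ det0.
have [||| W WZ] := @diff_simple_ideal R
  (fun r => exists W : 'M_n, W *m Z = r%:M) simR.
- move=> a b x y [W WZ] [W' WZ']; exists (a *: W + b *: W').
  by rewrite mulmxDl -!scalemxAl WZ WZ' !scale_scalar_mx raddfD.
- move=> x [W WZ]; exists (map_mx der W + W *m A).
  rewrite mulmxDl -mulmxA -dZ -der_mulmx WZ.
  by apply/matrixP => i j; rewrite !mxE; case: eqP; rewrite ?mulr1n ?mulr0n ?der0.
- by exists (\det Z) => //; exists (\adj Z); rewrite mul_adj_mx.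
by exists W; split=> //; apply: mulmx1C.
Qed.

Section Generators.
Variables (F : diffFieldType) (R : diffIdomainAlgType F).
Hypothesis const_frac : forall x : {fraction R},
  der x = 0 <-> exists c : const F, x = FracField.tofrac ((val c)%:A : R).
Variables (G : linAlgGroup (const F)) (act : action_on G R).
Hypothesis tors : is_diff_torsor act.
Local Notation H := (coord_ring G).
Local Notation S := (tensor R R).
Local Notation E := (lext R H).
Local Notation inl := (lext_inl R H).
Local Notation inr := (lext_inr R H).
Local Notation rho := (orbit_map act idfun).
Local Notation pi := (of_division tors).

Definition solution_pair n (Z W : 'M[R]_n) : Prop :=
  [/\ Z *m W = 1%:M, W *m Z = 1%:M &
      exists A : 'M[F]_n, map_mx der Z *m W = map_mx (in_alg R) A].

Lemma rho_normal (f : R) : exists n (a : nat -> R) (h : nat -> H),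
  rho f = \sum_(i < n) inl (a i) * inr (h i) /\
  forall a' : nat -> R, \sum_(i < n) inl (a' i) * inr (h i) = 0 ->
    forall i, (i < n)%N -> a' i = 0.
Proof.
have [n [a [h [fr fE]]]] := tens_normal (rho f : cext R H).
exists n, a, h; split=> [|a' a'0].
  by apply: etrans fE _; apply: eq_bigr => i _; rewrite -tens_inlr.
apply: (@tens_free _ (res R) (triv H) h a' n fr).
apply: etrans a'0; apply: eq_bigr => i _.
by rewrite -tens_inlr.
Qed.

Lemma rho_iter_der (f : R) n (a : nat -> R) (h : nat -> H) j :
  rho f = \sum_(i < n) inl (a i) * inr (h i) ->
  rho (iter j der f) = \sum_(i < n) inl (iter j der (a i)) * inr (h i).
Proof.
move=> fE; elim: j => //= j IHj; rewrite (orbit_map_der tors) IHj.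
elim/big_ind2: _ => [|x y x' y' <- <-|i _]; [exact: der0|exact: derD|].
exact: der_lext_mul.
Qed.

(* With [rho f = \sum a_i (x) h_i] and the [h_i] independent over K, the minimal
   linear differential equation of [f] over [F] is satisfied by all the [a_i],
   and its order is the rank of the matrix of derivatives of the [a_i]. *)
Lemma generator_solution (f : R) : exists n (Z W : 'M[R]_n),
  solution_pair Z W /\
  forall P : {pred R}, GRing.subalg_closed P ->
    (forall i j, Z i j \in P) -> f \in P.
Proof.
have [n [a [h [fE hfree]]]] := rho_normal f.
pose D j := iter j der f.
(* A relation [r] among the rows kills \sum r_j rho(D j). The torsor isomorphism turns this into
   \sum r_j (x) D j, and the D j are independent over F. *)
have cols m : free_upto D m -> forall r : 'rV[R]_m,
    r *m \matrix_(j < m, i < n) iter j der (a i) = 0 -> r = 0.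
  move=> Dfree r r0; apply/rowP => j; rewrite mxE.
  pose r' i := if insub i is Some k then r 0 k else 0.
  have r'E (k : 'I_m) : r' k = r 0 k by rewrite /r' valK.
  rewrite -r'E; apply: (@tens_free F R R D r' m) => //.
  have -> : \sum_(i < m) tens (r' i) (D i) =
      pi (\sum_(i < m) inl (r 0 i) * rho (D i)).
    rewrite raddf_sum /=; apply: eq_bigr => i _; rewrite rmorphM /= r'E.
    have -> : rho (D i) = to_division act (tinr (D i)).
      by rewrite /= tcopairE rmorph1 mul1r.
    by rewrite to_divisionK lcopair_inl -tensE.
  rewrite (eq_bigr (fun k : 'I_m =>
      \sum_(i < n) inl (r 0 k * iter k der (a i)) * inr (h i))).
    rewrite exchange_big /= big1 ?raddf0 // => i _; rewrite -mulr_suml -raddf_sum.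
    move/matrixP/(_ 0 i): r0; rewrite !mxE => r0.
    rewrite (_ : \sum_(k < m) _ = 0) ?raddf0 ?mul0r //.
    by rewrite -[RHS]r0; apply: eq_bigr => k _; rewrite mxE.
  move=> k _; rewrite (rho_iter_der k fE) mulr_sumr; apply: eq_bigr => i _.
  by rewrite mulrA -rmorphM.
(* Otherwise n + 1 independent derivatives would give n + 1 independent rows in a matrix with n
   columns. *)
have exm : exists m, `[< in_span D m (D m) >].
  apply: contrapT => nex.
  have /cols /independent_columns [] : free_upto D n.+1.
    by move=> j _ Dj; apply: nex; exists j; apply/asboolP.
  by rewrite ltnn.
have [m /asboolP [b bE] mmin] := ex_minnP exm.
have Dfree : free_upto D m.
  by move=> j ltjm /asboolP /mmin; rewrite leqNgt ltjm.
(* Apply [rho] to the equation of [f] and compare coefficients of the independent [h i]. *)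
have aE i : (i < n)%N -> iter m der (a i) = \sum_(k < m) b k *: iter k der (a i).
  move=> ltin; apply/eqP; rewrite -subr_eq0; apply/eqP.
  apply: (hfree (fun i => iter m der (a i) -
    \sum_(k < m) b k *: iter k der (a i))) ltin.
  rewrite (eq_bigr (fun i : 'I_n => inl (iter m der (a i)) * inr (h i) -
    \sum_(k < m) b k *: (inl (iter k der (a i)) * inr (h i)))).
    rewrite sumrB -(rho_iter_der m fE) exchange_big /= -/(D m) bE raddf_sum /=.
    apply/eqP; rewrite subr_eq0; apply/eqP; apply: eq_bigr => k _.
    by rewrite linearZ /= (rho_iter_der k fE) scaler_sumr.
  move=> i' _; rewrite raddfB mulrBl /=; congr (_ - _); rewrite raddf_sum mulr_suml.
  by apply: eq_bigr => k _; rewrite /= linearZ -scalerAl.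
(* The chosen columns form a Wronskian matrix of some of the solutions [a i]. *)
have [_ [phi det0]] := independent_columns (cols m Dfree).
set Z := colsub phi _ in det0.
pose A := companion m b; pose A' := map_mx (in_alg R) A.
have dZ : map_mx der Z = A' *m Z.
  apply/matrixP => j k; rewrite !mxE.
  rewrite -[LHS]/(iter j.+1 der (a (phi k))) (companionE (aE _ (ltn_ord _))).
  by apply: eq_bigr => l _; rewrite !mxE.
have [W [WZ ZW]] := solution_invertible (torsor_simple const_frac tors) dZ det0.
exists m, Z, W; split.
  by split=> //; exists A; rewrite dZ -mulmxA ZW mulmx1.
move=> P [P1 PL PM] ZP.
have P0 : 0 \in P by rewrite -(subrr 1) addrC -scaleN1r; apply: PL.
pose v : 'cV[R]_m := \col_j D j.
have dv : map_mx der v = A' *m v.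
  apply/matrixP => j k; rewrite !mxE -[LHS]/(iter j.+1 der f) (companionE bE).
  by apply: eq_bigr => l _; rewrite !mxE.
(* The coordinates W v of the solution vector [v] in the fundamental matrix Z are constant, hence in
   K. *)
have dy : map_mx der (W *m v) = 0.
  rewrite der_mulmx (solution_inverse_der WZ ZW dZ) dv mulNmx -mulmxA.
  by rewrite addrC mulmxA subrr.
have yE k : exists c : const F, (W *m v) k 0 = (val c)%:A.
  apply/(frac_constant const_frac); move/matrixP/(_ k 0): dy.
  by rewrite !mxE.
have vE : v = Z *m (W *m v) by rewrite mulmxA ZW mul1mx.
(* An equation of order zero forces f = 0. *)
case: (posnP m) => [m0|m_gt0].
  by rewrite -[f]/(D 0%N) -m0 bE m0 big_ord0.
have -> : f = v (Ordinal m_gt0) 0 by rewrite mxE.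
rewrite vE mxE; apply: (big_ind (fun x => is_true (x \in P))) => [//|x y Px Py|k _].
  by rewrite -[x]scale1r; apply: PL.
have [c ->] := yE k; rewrite mulr_algr -[_ *: _]addr0; exact: PL.
Qed.

Lemma solution_pair_block n n' (Z W : 'M[R]_n) (Z' W' : 'M[R]_n') :
  solution_pair Z W -> solution_pair Z' W' ->
  solution_pair (block_mx Z 0 0 Z') (block_mx W 0 0 W').
Proof.
move=> [ZW WZ [A AE]] [ZW' WZ' [A' AE']]; split.
- by rewrite mulmx_block !(mulmx0, mul0mx, addr0, add0r) ZW ZW' -scalar_mx_block.
- by rewrite mulmx_block !(mulmx0, mul0mx, addr0, add0r) WZ WZ' -scalar_mx_block.
exists (block_mx A 0 0 A').
have d0 p q : map_mx der (0 : 'M[R]_(p, q)) = 0.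
  by apply/matrixP => i j; rewrite !mxE der0.
rewrite map_block_mx !d0 mulmx_block !(mulmx0, mul0mx, addr0, add0r) AE AE'.
by rewrite map_block_mx !map_mx0.
Qed.

(** Block-diagonal matrices combine the fundamental matrices of the single generators, starting from
    the empty matrix. *)
Lemma solutions_generate (s : seq R) : exists n (Z W : 'M[R]_n),
  solution_pair Z W /\
  forall P : {pred R}, GRing.subalg_closed P -> (forall i j, Z i j \in P) ->
    {subset s <= P}.
Proof.
elim: s => [|f s [n [Z [W [ZW Zs]]]]].
  exists 0%N, 0, 0; split=> //; split; try by apply/matrixP => -[].
  by exists 0; apply/matrixP => -[].
have [n' [Z' [W' [ZW' Zf]]]] := generator_solution f.
exists (n + n')%N, (block_mx Z 0 0 Z'), (block_mx W 0 0 W').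
split=> [|P subP ZP]; first exact: solution_pair_block.
move=> x; rewrite in_cons => /orP[/eqP ->|].
  by apply: Zf => // i j; have := ZP (rshift n i) (rshift n j); rewrite block_mxEdr.
apply: Zs => // i j.
by have := ZP (lshift n' i) (lshift n' j); rewrite block_mxEul.
Qed.

Lemma torsor_PV : is_PV_ring R.
Proof.
split; last exact: (frac_constant const_frac).
- have [s sgen] := torsor_finite (diff_torsor tors).
  have [n [Z [W [[ZW WZ AE] Zs]]]] := solutions_generate s.
  exists n, Z, W; split=> // P subP ZP x.
  apply: sgen => // y; apply: Zs => // i j.
  by apply: ZP; left; exists i, j.
- exact: (torsor_simple const_frac tors).
Qed.
End Generators.

Theorem proposition1p12 (F : diffFieldType) (charF : [pchar F] =i pred0)
    (G : linAlgGroup (const F)) :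
  (forall (R : diffAlgType F) (theta : galois_group G R),
      is_PV_ring R ->
      is_diff_torsor (gal_act theta) /\ diff_simple R)
  /\
  (forall (R : diffIdomainAlgType F) (act : action_on G R),
      is_diff_torsor act ->
      (forall x : {fraction R},
         der x = 0 <->
         exists c : const F, x = FracField.tofrac ((val c)%:A : R)) ->
      is_PV_ring R /\
      exists theta : galois_group G R,
        forall (A : comAlgType F) (x : {lrmorphism R -> A})
          (g : {lrmorphism coord_ring G -> @res F A}),
          gal_act theta A x g = act A x g).
Proof.
split=> [R theta PV|R act tors const_frac].
  by split; [apply: PV_diff_torsor|apply: PV_simple].
split; first exact: (torsor_PV const_frac tors).
exists (torsor_galois tors (fun r => (frac_constant const_frac r).1)) => A x g.
exact: torsor_galois_act.
Qed.
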